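(* Let $0<\gamma\le1$, and let $\mathfrak F\subset\mathcal E_{n,\lambda,\Lambda}$ be nonempty, compact (in the topology of locally uniform convergence), and such that $\mathcal S_{A,t}G\in\mathfrak F$ whenever $G\in\mathfrak F$, $A\in\mathcal S^n$, $G(A)=0$ and $t>0$. Assume that for every $G\in\mathfrak F$, every ball $B\subset\mathbb R^n$ and every $u\in\mathcal H_G(B)$ one has $u\in C^{2,\gamma}_{\mathrm{loc}}(B)$. Then for every $0<\beta<\gamma$ there is $C_{\beta,\mathfrak F}<\infty$ such that $$R\|Du\|_{L^\infty(B_{R/2}(x_0))}+R^2\|D^2u\|_{L^\infty(B_{R/2}(x_0))}+R^{2+\beta}[D^2u]_{C^{0,\beta}(B_{R/2}(x_0))}\le C_{\beta,\mathfrak F}\operatorname{osc}_{B_R(x_0)}u$$ for every ball $B_R(x_0)$, every $G\in\mathfrak F$ and every $u\in\mathcal H_G(B_R(x_0))$.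
   Context: Fix $n\ge2$ and $0<\lambda\le\Lambda$. $\mathcal S^n$ is the space of real symmetric $n\times n$ matrices with the Frobenius norm; $N\ge0$ means positive semidefinite. $\mathcal E_{n,\lambda,\Lambda}$ is the set of $G\in C(\mathcal S^n)$ with $G(0)=0$ and $\lambda\operatorname{tr}N\le G(M+N)-G(M)\le\Lambda\operatorname{tr}N$ for all $M\in\mathcal S^n$, $N\ge0$; it carries the topology of locally uniform convergence on $\mathcal S^n$. For $A\in\mathcal S^n$, $t>0$, $(\mathcal S_{A,t}G)(M):=t[G(A+t^{-1}M)-G(A)]$. For an open set $\Omega$, $\mathcal H_G(\Omega)$ is the set of viscosity solutions of $G(D^2u)=0$ in $\Omega$: continuous $u$ such that, for $C^2$ test functions $\varphi$, $G(D^2\varphi(x))\ge0$ whenever $\varphi$ touches $u$ from above at $x\in\Omega$, and $G(D^2\varphi(x))\le0$ whenever $\varphi$ touches $u$ from below at $x\in\Omega$. $B_r(x_0)$ is the open ball. $\operatorname{osc}_Eu:=\sup_Eu-\inf_Eu$ (an inequality with right-hand side $+\infty$ is vacuous). For $0<\beta\le1$, $[g]_{C^{0,\beta}(E)}:=\sup_{x\ne y\in E}|g(x)-g(y)|/|x-y|^\beta$. *)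

(* Defs.v *)
From HB Require Import structures.
From mathcomp Require Import all_boot all_order all_algebra.
From mathcomp Require Import all_classical all_reals all_analysis.

Set Implicit Arguments.
Unset Strict Implicit.
Unset Printing Implicit Defensive.

Import Order.TTheory GRing.Theory Num.Theory.
Import numFieldNormedType.Exports.

Local Open Scope classical_set_scope.
Local Open Scope ring_scope.

Definition is_symmx (R : realType) (n : nat) : {pred 'M[R]_n} :=
  [pred M | M^T == M].

Record symM (R : realType) (n : nat) := SymM {
  symM_val :> 'M[R]_n;
  symM_valP : symM_val \in @is_symmx R n }.

Fact is_symmx_submod (R : realType) (n : nat) :
  submod_closed (@is_symmx R n).
Proof.
split; first by rewrite inE trmx0.
move=> a M N; rewrite !inE => /eqP MT /eqP NT.
by rewrite linearD linearZ /= MT NT.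
Qed.

HB.instance Definition _ (R : realType) (n : nat) :=
  GRing.isSubmodClosed.Build R 'M[R]_n (@is_symmx R n)
    (@is_symmx_submod R n).

HB.instance Definition _ (R : realType) (n : nat) :=
  [isSub for @symM_val R n].
HB.instance Definition _ (R : realType) (n : nat) :=
  [Choice of symM R n by <:].
HB.instance Definition _ (R : realType) (n : nat) :=
  [SubChoice_isSubLmodule of symM R n by <:].

(* The topology of [symM R n] is induced from ['M[R]_n], whose library norm is
   the max norm; it is the topology of the Frobenius norm. *)
HB.instance Definition _ (R : realType) (n : nat) :=
  PseudoMetric.copy (symM R n) (initial_topology (@symM_val R n)).

Fact sympart_subproof (R : realType) (n : nat) (M : 'M[R]_n) :
  2^-1 *: (M + M^T) \in @is_symmx R n.
Proof. by rewrite inE linearZ linearD /= trmxK addrC. Qed.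

Definition sympart (R : realType) (n : nat) (M : 'M[R]_n) : symM R n :=
  SymM (sympart_subproof M).

Definition psd (R : realType) (n : nat) (N : symM R n) : Prop :=
  forall v : 'rV[R]_n, 0 <= (v *m N *m v^T) 0 0.

Definition elliptic (R : realType) (n : nat) (lam Lam : R) :
    set (symM R n -> R) :=
  [set G | [/\ continuous G, G 0 = 0 &
    forall M N : symM R n, psd N ->
      lam * \tr N <= G (M + N) - G M <= Lam * \tr N]].

Definition shift_scale (R : realType) (n : nat) (A : symM R n) (t : R)
    (G : symM R n -> R) : symM R n -> R :=
  fun M => t * (G (A + t^-1 *: M) - G A).

(* Frobenius norm on matrices, Euclidean norm on row vectors. *)
Definition l2norm (R : realType) (m n : nat) (A : 'M[R]_(m, n)) : R :=
  Num.sqrt (\sum_i \sum_j A i j ^+ 2).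

(* The library's [ball] on ['rV[R]_n] is a cube (max norm), hence: *)
Definition eball (R : realType) (n : nat) (x0 : 'rV[R]_n) (r : R) :
    set 'rV[R]_n :=
  [set x | l2norm (x - x0) < r].

Definition partial (R : realType) (n : nat) (i : 'I_n) (u : 'rV[R]_n -> R) :
    'rV[R]_n -> R :=
  'D_(delta_mx 0 i) u.

Definition grad (R : realType) (n : nat) (u : 'rV[R]_n -> R) (x : 'rV[R]_n) :
    'rV[R]_n :=
  \row_i partial i u x.

Definition hessian (R : realType) (n : nat) (u : 'rV[R]_n -> R)
    (x : 'rV[R]_n) : 'M[R]_n :=
  \matrix_(i, j) partial i (partial j u) x.

(* Meaningful for open [U]: then only the values of [u] on [U] matter. *)
Definition C2 (R : realType) (n : nat) (U : set 'rV[R]_n)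
    (u : 'rV[R]_n -> R) : Prop :=
  forall x, U x ->
    [/\ {for x, continuous u},
        forall i, derivable u x (delta_mx 0 i) /\
          {for x, continuous (partial i u)} &
        forall i j, derivable (partial j u) x (delta_mx 0 i) /\
          {for x, continuous (partial i (partial j u))}].

Definition touches_above (R : realType) (n : nat) (phi u : 'rV[R]_n -> R)
    (x : 'rV[R]_n) : Prop :=
  phi x = u x /\ \forall y \near x, u y <= phi y.

Definition touches_below (R : realType) (n : nat) (phi u : 'rV[R]_n -> R)
    (x : 'rV[R]_n) : Prop :=
  phi x = u x /\ \forall y \near x, phi y <= u y.

(* Test functions are C^2 near the contact point.  There the Hessian is
   symmetric by Schwarz's theorem, so [sympart] leaves it unchanged and only
   casts it to [symM R n]. *)
Definition visc_sol (R : realType) (n : nat) (G : symM R n -> R)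
    (Omega : set 'rV[R]_n) : set ('rV[R]_n -> R) :=
  [set u | [/\ forall x, Omega x -> {for x, continuous u},
    forall x V phi, Omega x -> open_nbhs x V -> C2 V phi ->
      touches_above phi u x -> 0 <= G (sympart (hessian phi x)) &
    forall x V phi, Omega x -> open_nbhs x V -> C2 V phi ->
      touches_below phi u x -> G (sympart (hessian phi x)) <= 0]].

(* Equals the L^oo norm when [g] is continuous and [E] is open. *)
Definition sup_norm (R : realType) (m n p : nat) (g : 'rV[R]_n -> 'M[R]_(m, p))
    (E : set 'rV[R]_n) : \bar R :=
  ereal_sup [set (l2norm (g x))%:E | x in E].

Definition hoelder_seminorm (R : realType) (m n p : nat) (beta : R)
    (g : 'rV[R]_n -> 'M[R]_(m, p)) (E : set 'rV[R]_n) : \bar R :=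
  ereal_sup [set q | exists x y, [/\ E x, E y, x <> y &
    q = (l2norm (g x - g y) / l2norm (x - y) `^ beta)%:E]].

Definition osc (R : realType) (n : nat) (E : set 'rV[R]_n)
    (u : 'rV[R]_n -> R) : \bar R :=
  (ereal_sup [set (u x)%:E | x in E] - ereal_inf [set (u x)%:E | x in E])%E.

Definition C2hoelder_loc (R : realType) (n : nat) (gamma : R)
    (U : set 'rV[R]_n) (u : 'rV[R]_n -> R) : Prop :=
  C2 U u /\
  forall K, compact K -> K `<=` U ->
    (hoelder_seminorm gamma (hessian u) K < +oo)%E.

(* Main.v *)
Require Import Defs.
From mathcomp Require Import all_boot all_order all_algebra.
From mathcomp Require Import all_classical all_reals all_analysis.
From mathcomp Require Import ring lra.

Set Implicit Arguments.
Unset Strict Implicit.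
Unset Printing Implicit Defensive.

Import Order.TTheory GRing.Theory Num.Theory.
Import numFieldNormedType.Exports.

Local Open Scope classical_set_scope.
Local Open Scope ring_scope.

(** Qualitative regularity becomes quantitative through compactness, and the
    power lost between [gamma] and [beta] absorbs the constants on which there is
    no control.

    Call a solution normalized if it solves some [G] of the family in the unit
    ball and is bounded there by [1]. Since every solution is [C^2], the classical
    doubling of variables applies without any theory of weak second derivatives:
    at a maximum of [u x - u y - L |x - y| + M |x - y| ^ 2 - 32 |x - x0| ^ 2] the
    two Hessians contradict uniform ellipticity. Normalized solutions are
    therefore Lipschitz on the half ball with a constant depending only on [n],
    [lam] and [Lam] ([interior_lipschitz]). As a consequence, limits of normalized
    solutions along an ultrafilter are uniform, and they are viscosity solutions
    for a limit operator, which the compactness of the family keeps inside the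
    family ([subsol_stable], [limit_solution]).

    The heart of the proof is [exists_scale]: there is [delta > 0] such that each
    normalized [u] is within [rho ^ (2 + beta)] of a quadratic polynomial [P] with
    [G (D^2 P) = 0] on the ball of radius [rho], for some [rho] between [delta] and
    [1/2] that depends on [u]. If this failed, a limit [u] of counterexamples would
    have, by assumption, a remainder [C |x| ^ (2 + gamma)] in its expansion at the
    origin, with some constant [C] of its own. This is below
    [rho ^ (2 + beta) / 2] for some small [rho], and the counterexamples close to
    [u] would be approximable at that scale.

    The rescaled remainder [rho ^ - (2 + beta) * (u - P) (rho x)] is again a
    normalized solution, for an operator that the family contains because it is
    closed under shifts and scalings. Iterating gives approximation by quadratic
    polynomials with error [C r ^ (2 + beta)] at all scales and all points of the
    half ball ([approximation_at_point]). As mixed second differences of quadratic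
    polynomials are constant, those of [u], divided by [s ^ 2], are at distance
    [O (s ^ beta)] from each other and from the entries of [D^2 u]
    ([quotient_hessian]), which yields the bound and the Hoelder bound for the
    Hessian. A final affine change of variables reduces the general case to
    normalized solutions ([estimate_by_osc]). *)

(** * Euclidean geometry *)

Lemma sum_cauchy_schwarz (R : realFieldType) (I : finType) (a b : I -> R) :
  (\sum_i a i * b i) ^+ 2 <= (\sum_i a i ^+ 2) * (\sum_i b i ^+ 2).
Proof.
set A := \sum_i a i ^+ 2; set B := \sum_i b i ^+ 2; set D := \sum_i _ * _.
have A0 : 0 <= A by apply: sumr_ge0 => i _; exact: sqr_ge0.
have expand s d : \sum_i (s * b i - d * a i) ^+ 2
    = s ^+ 2 * B - (2 * s * d) * D + d ^+ 2 * A.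
  rewrite /A /B /D !mulr_sumr -sumrB -big_split /=.
  by apply: eq_bigr => i _; ring.
have [A00|An0] := eqVneq A 0.
  have a0 i : a i = 0.
    apply/eqP; rewrite -sqrf_eq0; apply/eqP.
    have /psumr_eq0P -> // : \sum_i a i ^+ 2 = 0 by [].
    by move=> j _; exact: sqr_ge0.
  by rewrite A00 mul0r /D big1 ?expr0n// => i _; rewrite a0 mul0r.
have Agt0 : 0 < A by rewrite lt_def An0.
have : 0 <= \sum_i (A * b i - D * a i) ^+ 2.
  by apply: sumr_ge0 => i _; exact: sqr_ge0.
rewrite expand.
have -> : A ^+ 2 * B - (2 * A * D) * D + D ^+ 2 * A = A * (A * B - D ^+ 2).
  by ring.
by rewrite pmulr_rge0// subr_ge0.
Qed.

Lemma l2norm_pair (R : realType) m n (A : 'M[R]_(m, n)) :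
  l2norm A = Num.sqrt (\sum_(p : 'I_m * 'I_n) A p.1 p.2 ^+ 2).
Proof. by rewrite /l2norm pair_bigA. Qed.

Lemma l2norm_ge0 (R : realType) m n (A : 'M[R]_(m, n)) : 0 <= l2norm A.
Proof. exact: sqrtr_ge0. Qed.

Lemma sqr_l2norm (R : realType) m n (A : 'M[R]_(m, n)) :
  l2norm A ^+ 2 = \sum_(p : 'I_m * 'I_n) A p.1 p.2 ^+ 2.
Proof.
by rewrite l2norm_pair sqr_sqrtr// sumr_ge0// => p _; exact: sqr_ge0.
Qed.

Lemma sqr_l2norm_row (R : realType) n (x : 'rV[R]_n) :
  l2norm x ^+ 2 = \sum_i x 0 i ^+ 2.
Proof.
rewrite /l2norm big_ord1 sqr_sqrtr// sumr_ge0// => p _; exact: sqr_ge0.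
Qed.

Lemma l2normZ (R : realType) m n (k : R) (A : 'M[R]_(m, n)) :
  l2norm (k *: A) = `|k| * l2norm A.
Proof.
apply/eqP; rewrite -(@eqrXn2 _ 2)// ?mulr_ge0 ?l2norm_ge0//.
rewrite exprMn !sqr_l2norm mulr_sumr real_normK ?num_real//.
by apply/eqP; apply: eq_bigr => p _; rewrite mxE exprMn.
Qed.

Lemma l2norm0 (R : realType) m n : l2norm (0 : 'M[R]_(m, n)) = 0.
Proof. by rewrite -(scale0r (0 : 'M[R]_(m, n))) l2normZ normr0 mul0r. Qed.

Lemma l2normN (R : realType) m n (A : 'M[R]_(m, n)) : l2norm (- A) = l2norm A.
Proof. by rewrite -scaleN1r l2normZ normrN normr1 mul1r. Qed.

Lemma l2normBC (R : realType) m n (A B : 'M[R]_(m, n)) :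
  l2norm (A - B) = l2norm (B - A).
Proof. by rewrite -l2normN opprB. Qed.

Lemma l2normD (R : realType) m n (A B : 'M[R]_(m, n)) :
  l2norm (A + B) <= l2norm A + l2norm B.
Proof.
rewrite -(@ler_pXn2r _ 2) ?nnegrE ?addr_ge0 ?l2norm_ge0//.
rewrite sqrrD !sqr_l2norm.
have -> : \sum_p (A + B) p.1 p.2 ^+ 2 = \sum_p A p.1 p.2 ^+ 2
    + (\sum_p A p.1 p.2 * B p.1 p.2) *+ 2 + \sum_p B p.1 p.2 ^+ 2.
  rewrite -sumrMnl -!big_split /=.
  by apply: eq_bigr => p _; rewrite mxE sqrrD.
rewrite lerD2r lerD2l lerMn2r/=.
apply: le_trans (ler_norm _) _.
rewrite -(@ler_pXn2r _ 2) ?nnegrE ?mulr_ge0 ?l2norm_ge0//.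
rewrite real_normK ?num_real// exprMn !sqr_l2norm.
exact: sum_cauchy_schwarz.
Qed.

Lemma l2normB_triangle (R : realType) m n (B A C : 'M[R]_(m, n)) :
  l2norm (A - C) <= l2norm (A - B) + l2norm (B - C).
Proof.
by have := l2normD (A - B) (B - C); rewrite addrA subrK.
Qed.

Lemma coord_le_l2norm (R : realType) m n (A : 'M[R]_(m, n)) i j :
  `|A i j| <= l2norm A.
Proof.
rewrite -(@ler_pXn2r _ 2) ?nnegrE ?l2norm_ge0// real_normK ?num_real//.
rewrite sqr_l2norm (bigD1 (i, j))//= lerDl sumr_ge0// => p _.
exact: sqr_ge0.
Qed.

Lemma l2norm_le_sum (R : realType) m n (A : 'M[R]_(m, n)) :
  l2norm A <= \sum_(p : 'I_m * 'I_n) `|A p.1 p.2|.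
Proof.
have S0 : 0 <= \sum_(p : 'I_m * 'I_n) `|A p.1 p.2| by rewrite sumr_ge0.
rewrite -(@ler_pXn2r _ 2) ?nnegrE ?l2norm_ge0// sqr_l2norm [leRHS]expr2.
rewrite mulr_sumr ler_sum// => p _.
rewrite -(real_normK (num_real (A _ _))) expr2 ler_wpM2r//.
by rewrite (bigD1 p)//= lerDl sumr_ge0.
Qed.

Lemma l2norm_le_entries (R : realType) m n (A : 'M[R]_(m, n)) (K : R) :
  (forall i j, `|A i j| <= K) -> l2norm A <= (m * n)%:R * K.
Proof.
move=> AK; apply: (le_trans (l2norm_le_sum A)).
apply: (@le_trans _ _ (\sum_(p : 'I_m * 'I_n) K)).
  by apply: ler_sum => p _; exact: AK.
by rewrite sumr_const card_prod !card_ord mulr_natl.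
Qed.

Lemma entry_le_norm (R : realType) m n (A : 'M[R]_(m, n)) i j :
  `|A i j| <= `|A|.
Proof.
rewrite [leRHS]/Num.norm /= mx_normrE.
by apply/bigmax_geP; right => /=; exists (i, j).
Qed.

Lemma norm_le_l2norm (R : realType) m n (A : 'M[R]_(m, n)) :
  `|A| <= l2norm A.
Proof.
rewrite [leLHS]/Num.norm /= mx_normrE; apply/bigmax_leP; split.
  exact: l2norm_ge0.
by move=> p _; exact: coord_le_l2norm.
Qed.

Lemma l2norm_le_norm (R : realType) m n (A : 'M[R]_(m, n)) :
  l2norm A <= (m * n)%:R * `|A|.
Proof. by apply: l2norm_le_entries => i j; exact: entry_le_norm. Qed.

Lemma l2norm_eq0 (R : realType) m n (A : 'M[R]_(m, n)) : l2norm A = 0 -> A = 0.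
Proof.
move=> A0; apply/matrixP => i j; rewrite mxE; apply/eqP.
by rewrite -normr_le0 -A0 coord_le_l2norm.
Qed.

Lemma l2norm_gt0 (R : realType) m n (A : 'M[R]_(m, n)) :
  A <> 0 -> 0 < l2norm A.
Proof.
move=> A0; rewrite lt_def l2norm_ge0 andbT.
by apply/eqP => /l2norm_eq0.
Qed.

Lemma nbhs_eballP (R : realType) n (x : 'rV[R]_n) (P : set 'rV[R]_n) :
  nbhs x P <-> exists2 r, 0 < r & eball x r `<=` P.
Proof.
split.
  move=> /nbhs_ballP[r /= r0 rP]; exists r => // y; rewrite /eball/= => yr.
  apply: rP; rewrite mx_norm_ball /ball_/=.
  by rewrite distrC (le_lt_trans (norm_le_l2norm _)).
move=> [r r0 rP]; apply/nbhs_ballP; exists (r / n.+1%:R) => /=.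
  by rewrite divr_gt0.
move=> y; rewrite mx_norm_ball /ball_/= distrC => yr; apply: rP.
rewrite /eball/=; apply: (le_lt_trans (l2norm_le_norm _)).
rewrite mul1n; apply: (@le_lt_trans _ _ (n.+1%:R * `|y - x|)).
  by rewrite ler_wpM2r// ler_nat.
by rewrite mulrC -ltr_pdivlMr.
Qed.

Lemma open_eball (R : realType) n (x : 'rV[R]_n) r : open (eball x r).
Proof.
rewrite openE => y yr; apply/nbhs_eballP.
exists (r - l2norm (y - x)); first by rewrite subr_gt0.
move=> z; rewrite /eball/= ltrBrDr => zy.
exact: le_lt_trans (l2normB_triangle y z x) zy.
Qed.

Lemma eball_center (R : realType) n (x : 'rV[R]_n) r : 0 < r -> eball x r x.
Proof. by move=> r0; rewrite /eball/= subrr l2norm0. Qed.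

Lemma nbhs_eball (R : realType) n (x y : 'rV[R]_n) r :
  eball x r y -> nbhs y (eball x r).
Proof. by move=> xy; apply: open_nbhs_nbhs; split=> //; exact: open_eball. Qed.

Lemma l2norm_dist_le (R : realType) m n (A B : 'M[R]_(m, n)) :
  `|l2norm A - l2norm B| <= l2norm (A - B).
Proof.
have H (C D : 'M[R]_(m, n)) : l2norm C - l2norm D <= l2norm (C - D).
  by rewrite lerBlDr; have := l2normD (C - D) D; rewrite subrK.
by rewrite ler_norml H andbT lerNl opprB l2normBC H.
Qed.

Lemma continuous_eballP (R : realType) n (f : 'rV[R]_n -> R) (x : 'rV[R]_n) :
  {for x, continuous f} <->
  forall e, 0 < e -> exists2 d, 0 < d &
    forall y, eball x d y -> `|f x - f y| < e.
Proof.
split=> [/(@cvgrPdist_lt _ _ _ (nbhs x) _) fx e e0|fx].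
  by have /nbhs_eballP := fx e e0.
apply/(@cvgrPdist_lt _ _ _ (nbhs x) _) => e /fx fe; exact/nbhs_eballP.
Qed.

Lemma continuous_l2norm (R : realType) n (x : 'rV[R]_n) :
  continuous (fun y : 'rV[R]_n => l2norm (y - x)).
Proof.
move=> y; apply/continuous_eballP => e e0.
exists e => // z; rewrite /eball/= => zy.
apply: le_lt_trans zy; apply: le_trans (l2norm_dist_le _ _) _.
by rewrite opprB addrA subrK l2normBC.
Qed.

Definition ceball (R : realType) n (x : 'rV[R]_n) (r : R) : set 'rV[R]_n :=
  [set y | l2norm (y - x) <= r].

Lemma compact_ceball (R : realType) n (x : 'rV[R]_n) r : compact (ceball x r).
Proof.
apply: bounded_closed_compact.
  exists (`|x| + r); split; first exact: num_real.
  move=> M xM y; rewrite /ceball/= => yr.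
  apply: le_trans (ltW xM); rewrite -lerBlDl.
  apply: le_trans yr; apply: le_trans (norm_le_l2norm _).
  exact: lerB_dist.
have -> : ceball x r = (fun y => l2norm (y - x)) @^-1` [set z | z <= r] by [].
apply: closed_comp; last exact: closed_le.
by move=> y _; exact: continuous_l2norm.
Qed.

Lemma eball_sub (R : realType) n (x y : 'rV[R]_n) (r s : R) :
  l2norm (y - x) + s <= r -> eball y s `<=` eball x r.
Proof.
move=> xyr z; rewrite /eball/= => zy.
apply: (le_lt_trans (l2normB_triangle y _ _)); lra.
Qed.

Lemma eball_open_nbhs (R : realType) n (x : 'rV[R]_n) (V : set 'rV[R]_n) :
  open_nbhs x V -> exists2 r, 0 < r & eball x r `<=` V.
Proof. by move=> /open_nbhs_nbhs /nbhs_eballP. Qed.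

Definition bform (R : realType) n (M : 'M[R]_n) (v w : 'rV[R]_n) : R :=
  \sum_i \sum_j v 0 i * M i j * w 0 j.

Notation qform M v := (bform M v v).

Lemma bformE (R : realType) n (M : 'M[R]_n) (v w : 'rV[R]_n) :
  (v *m M *m w^T) 0 0 = bform M v w.
Proof.
rewrite mxE /bform exchange_big/=; apply: eq_bigr => j _.
by rewrite !mxE mulr_suml.
Qed.

Lemma bformDl (R : realType) n (M : 'M[R]_n) u v w :
  bform M (u + v) w = bform M u w + bform M v w.
Proof. by rewrite -!bformE !mulmxDl mxE. Qed.

Lemma bformDr (R : realType) n (M : 'M[R]_n) u v w :
  bform M u (v + w) = bform M u v + bform M u w.
Proof. by rewrite -!bformE linearD/= mulmxDr mxE. Qed.

Lemma bformZl (R : realType) n (M : 'M[R]_n) k v w :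
  bform M (k *: v) w = k * bform M v w.
Proof. by rewrite -!bformE -!scalemxAl mxE. Qed.

Lemma bformZr (R : realType) n (M : 'M[R]_n) k v w :
  bform M v (k *: w) = k * bform M v w.
Proof. by rewrite -!bformE linearZ/= -scalemxAr mxE. Qed.

Lemma bformDM (R : realType) n (M N : 'M[R]_n) v w :
  bform (M + N) v w = bform M v w + bform N v w.
Proof. by rewrite -!bformE mulmxDr mulmxDl mxE. Qed.

Lemma bformZM (R : realType) n (M : 'M[R]_n) k v w :
  bform (k *: M) v w = k * bform M v w.
Proof. by rewrite -!bformE -scalemxAr -scalemxAl mxE. Qed.

Lemma bformBM (R : realType) n (M N : 'M[R]_n) v w :
  bform (M - N) v w = bform M v w - bform N v w.
Proof. by rewrite bformDM -scaleN1r bformZM mulN1r. Qed.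

Lemma bformT (R : realType) n (M : 'M[R]_n) v w :
  bform M^T v w = bform M w v.
Proof.
rewrite /bform exchange_big/=; apply: eq_bigr => i _; apply: eq_bigr => j _.
by rewrite mxE; ring.
Qed.

Lemma bform_delta (R : realType) n (M : 'M[R]_n) i j :
  bform M (delta_mx 0 i) (delta_mx 0 j) = M i j.
Proof. by rewrite -bformE -rowE trmx_delta -colE !mxE. Qed.

Lemma qform_scalar (R : realType) n (k : R) (v : 'rV[R]_n) :
  qform (k%:M) v = k * l2norm v ^+ 2.
Proof.
rewrite -bformE mul_mx_scalar -scalemxAl mxE sqr_l2norm_row mxE.
by congr (_ * _); apply: eq_bigr => i _; rewrite mxE expr2.
Qed.

Lemma qform_sympart (R : realType) n (M : 'M[R]_n) (v : 'rV[R]_n) :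
  qform (sympart M) v = qform M v.
Proof. by rewrite /sympart/= bformZM bformDM bformT; field. Qed.

Lemma qform_le_l2norm (R : realType) n (M : 'M[R]_n) (v : 'rV[R]_n) :
  `|qform M v| <= l2norm M * l2norm v ^+ 2.
Proof.
rewrite -(@ler_pXn2r _ 2) ?nnegrE ?mulr_ge0 ?exprn_ge0 ?l2norm_ge0//.
rewrite real_normK ?num_real// exprMn (sqr_l2norm M).
rewrite /bform pair_bigA/=.
have -> : \sum_p v 0 p.1 * M p.1 p.2 * v 0 p.2
    = \sum_(p : 'I_n * 'I_n) M p.1 p.2 * (v 0 p.1 * v 0 p.2).
  by apply: eq_bigr => p _; ring.
apply: (le_trans (sum_cauchy_schwarz _ _)).
apply: ler_wpM2l; first by apply: sumr_ge0 => p _; exact: sqr_ge0.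
rewrite sqr_l2norm_row expr2 mulr_suml.
rewrite (eq_bigr (fun i => \sum_j v 0 i ^+ 2 * v 0 j ^+ 2)); last first.
  by move=> i _; rewrite mulr_sumr.
by rewrite pair_bigA/=; apply: ler_sum => p _; rewrite exprMn.
Qed.

(** * Differential calculus from continuous partial derivatives *)

Lemma is_derive_line (R : realType) n (f : 'rV[R]_n -> R) (y e : 'rV[R]_n)
    (s : R) : derivable f (y + s *: e) e ->
  is_derive s 1 (fun h : R => f (y + h *: e)) ('D_e f (y + s *: e)).
Proof.
move=> df.
have E : (fun h : R => h^-1 *: (((fun k : R => f (y + k *: e)) \o shift s)
      (h *: (1 : R)) - f (y + s *: e)))
    = (fun h => h^-1 *: ((f \o shift (y + s *: e)) (h *: e)
      - f (y + s *: e))).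
  apply/funext => h /=; congr (_ *: (f _ - _)).
  by rewrite [h *: 1]mulr1 scalerDl addrCA addrA.
by apply: DeriveDef; [rewrite /derivable E | rewrite /derive E].
Qed.

Lemma MVT_abs (R : realType) (g dg : R -> R) (a : R) :
  (forall s : R, `|s| <= `|a| -> is_derive s 1 g (dg s)) ->
  exists2 c, `|c| <= `|a| & g a - g 0 = dg c * a.
Proof.
move=> gd; have [a0|a0] := leP 0 a.
  have H s : s \in `[0, a] -> `|s| <= `|a|.
    by rewrite in_itv/= => /andP[s0 sa]; rewrite !ger0_norm.
  have [||c cin E] := @MVT_segment R g dg 0 a a0.
  - by move=> s /subset_itv_oo_cc /H; exact: gd.
  - by apply: derivable_within_continuous => s /H /gd.
  by exists c; [exact: H|rewrite E subr0].
have H s : s \in `[a, 0] -> `|s| <= `|a|.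
  by rewrite in_itv/= => /andP[s0 sa]; rewrite !ler0_norm ?lerN2// ltW.
have [||c cin E] := @MVT_segment R g dg a 0 (ltW a0).
- by move=> s /subset_itv_oo_cc /H; exact: gd.
- by apply: derivable_within_continuous => s /H /gd.
exists c; first exact: H.
by rewrite -opprB E; ring.
Qed.

Lemma l2norm_le_coord (R : realType) n (a b : 'rV[R]_n) :
  (forall i, `|a 0 i| <= `|b 0 i|) -> l2norm a <= l2norm b.
Proof.
move=> ab; rewrite -(@ler_pXn2r _ 2) ?nnegrE ?l2norm_ge0//.
rewrite !sqr_l2norm_row; apply: ler_sum => i _.
by rewrite -(real_normK (num_real (a 0 i))) -(real_normK (num_real (b 0 i)))
           ler_pXn2r ?nnegrE.
Qed.

Lemma l2norm_delta (R : realType) n (i : 'I_n) :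
  l2norm (delta_mx 0 i : 'rV[R]_n) = 1.
Proof.
apply/eqP; rewrite -(@eqrXn2 _ 2)// ?l2norm_ge0// sqr_l2norm_row expr1n.
rewrite (bigD1 i)//= mxE !eqxx/= expr1n big1 ?addr0// => j ji.
by rewrite mxE (negbTE ji) andbF expr0n.
Qed.

(** The path from [x] to [x + v] that changes one coordinate at a time stays in
    the ball, because every intermediate displacement is dominated by [v]
    coordinate by coordinate; on each piece the one-variable theorem applies. *)
Lemma multivariate_MVT (R : realType) n (f : 'rV[R]_n -> R) (x v : 'rV[R]_n)
    (r : R) :
  (forall y i, eball x r y -> derivable f y (delta_mx 0 i)) ->
  l2norm v < r ->
  exists2 z : 'I_n -> 'rV[R]_n, forall i, l2norm (z i - x) <= l2norm v &
    f (x + v) - f x = \sum_i v 0 i * partial i f (z i).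
Proof.
move=> df vr.
pose w (k : nat) : 'rV[R]_n := \row_i (if (i < k)%N then v 0 i else 0).
have wS (k : 'I_n) : w k.+1 = w k + v 0 k *: delta_mx 0 k.
  apply/rowP => i; rewrite !mxE ltnS leq_eqVlt /=.
  rewrite (inj_eq val_inj).
  have [->|ik] := eqVneq i k; first by rewrite /= ltnn add0r mulr1.
  by rewrite /= mulr0 addr0.
have tel : f (x + v) - f x = \sum_(k < n) (f (x + w k.+1) - f (x + w k)).
  rewrite -(big_mkord xpredT (fun k => f (x + w k.+1) - f (x + w k))).
  rewrite telescope_sumr//.
  have -> : w n = v by apply/rowP => i; rewrite !mxE ltn_ord.
  have -> : w 0%N = 0 by apply/rowP => i; rewrite !mxE.
  by rewrite addr0.
have step (k : 'I_n) : exists z, l2norm (z - x) <= l2norm v /\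
    f (x + w k.+1) - f (x + w k) = v 0 k * partial k f z.
  have near s : `|s| <= `|v 0 k| ->
      l2norm (x + w k + s *: delta_mx 0 k - x) <= l2norm v.
    move=> sv; have -> : x + w k + s *: delta_mx 0 k - x
        = w k + s *: delta_mx 0 k by rewrite -(addrA x) addrAC subrr add0r.
    apply: l2norm_le_coord => i; rewrite !mxE.
    have [->|ik] := eqVneq i k; first by rewrite ltnn add0r mulr1.
    by rewrite mulr0 addr0; case: ifP => // _; rewrite normr0.
  have [|c cv E] := @MVT_abs R (fun s => f (x + w k + s *: delta_mx 0 k))
      (fun s => partial k f (x + w k + s *: delta_mx 0 k)) (v 0 k).
    move=> s /near sv; apply: is_derive_line; apply: df.
    exact: le_lt_trans sv vr.
  exists (x + w k + c *: delta_mx 0 k); split; first exact: near.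
  by rewrite wS addrA mulrC -E scale0r addr0.
have [z zP] := choice step.
exists z; first by move=> i; have [] := zP i.
by rewrite tel; apply: eq_bigr => k _; have [] := zP k.
Qed.

(** Continuity of the partial derivatives makes the mean values of
    [multivariate_MVT] converge, hence all directional derivatives exist and are
    linear in the direction. *)
Lemma is_derive_along (R : realType) n (f : 'rV[R]_n -> R) (x v : 'rV[R]_n)
    (r : R) : 0 < r ->
  (forall y i, eball x r y -> derivable f y (delta_mx 0 i)) ->
  (forall i, {for x, continuous (partial i f)}) ->
  is_derive x v f (\sum_i v 0 i * partial i f x).
Proof.
move=> r0 df cf; set d := \sum_i _.
suff H : h^-1 *: ((f \o shift x) (h *: v) - f x) @[h --> 0^'] --> d.
  by apply: DeriveDef; [apply/cvg_ex; exists d | exact: cvg_lim].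
apply/cvgrPdist_le => e e0.
pose S := \sum_i `|v 0 i| + 1.
have S0 : 0 < S by rewrite ltr_wpDl// sumr_ge0.
have : \forall y \near x, forall i, `|partial i f x - partial i f y| < e / S.
  apply: (@filter_forall _ _ (fun i y => `|partial i f x - partial i f y| < e / S) (nbhs x)) => i.
  apply/nbhs_eballP.
  by have /continuous_eballP := cf i; apply; rewrite divr_gt0.
move=> /nbhs_eballP[t t0 tP].
pose q := Num.min r t.
have q0 : 0 < q by rewrite lt_min r0.
have nz : \forall h \near (0:R)^', h != 0 by exact: nbhs_dnbhs_neq.
have nq : \forall h \near (0:R)^', `|h| * (l2norm v + 1) < q.
  have p0 : 0 < q / (l2norm v + 1).
    by rewrite divr_gt0// ltr_wpDl// l2norm_ge0.
  near=> h; rewrite -ltr_pdivlMr ?ltr_wpDl ?l2norm_ge0//.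
  near: h; exact: dnbhs0_lt.
near=> h.
have h0 : h != 0 by near: h.
have hq : l2norm (h *: v) < q.
  rewrite l2normZ; apply: le_lt_trans (_ : `|h| * (l2norm v + 1) < q).
    by rewrite ler_wpM2l// lerDl.
  by near: h.
have hr : l2norm (h *: v) < r by rewrite (lt_le_trans hq)// ge_min lexx.
have [z zx /=] := multivariate_MVT df hr.
rewrite [h *: v + x]addrC => ->.
have -> : d - h^-1 *: (\sum_i (h *: v) 0 i * partial i f (z i))
    = \sum_i v 0 i * (partial i f x - partial i f (z i)).
  rewrite [_ *: _]mulr_sumr -sumrB; apply: eq_bigr => i _.
  by rewrite !mxE mulrBr; congr (_ - _); rewrite mulrA mulrA mulVf// mul1r.
apply: (le_trans (ler_norm_sum _ _ _)).
apply: (@le_trans _ _ (\sum_i `|v 0 i| * (e / S))).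
  apply: ler_sum => i _; rewrite normrM ler_wpM2l// ltW//; apply: tP.
  rewrite /eball/=; apply: le_lt_trans (zx i) _.
  by rewrite (lt_le_trans hq)// ge_min lexx orbT.
rewrite -mulr_suml mulrCA ger_pMr// ler_pdivrMr// mul1r /S lerDl//.
Unshelve. all: by end_near. Qed.

Lemma C2_sub (R : realType) n (U V : set 'rV[R]_n) u :
  V `<=` U -> C2 U u -> C2 V u.
Proof. by move=> VU Uu x /VU /Uu. Qed.

(** Along the segment from [x] to [x + v] the second derivative differs from its
    initial value by the quadratic form of a difference of Hessians; two mean
    value steps integrate this bound. *)
Lemma taylor2 (R : realType) n (u : 'rV[R]_n -> R) (x v : 'rV[R]_n) (r eta : R) :
  C2 (eball x r) u ->
  (forall y, eball x r y -> l2norm (hessian u y - hessian u x) <= eta) ->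
  l2norm v < r ->
  `|u (x + v) - u x - \sum_i v 0 i * partial i u x
    - 2^-1 * qform (hessian u x) v| <= eta * l2norm v ^+ 2.
Proof.
move=> u2 Hu vr.
have r0 : 0 < r by rewrite (le_lt_trans _ vr)// l2norm_ge0.
have inB (h : R) : `|h| <= `|1 : R| -> eball x r (x + h *: v).
  rewrite normr1 => h1; rewrite /eball/= addrAC subrr add0r l2normZ.
  by rewrite (le_lt_trans _ vr)// ler_piMl// l2norm_ge0.
have sub (h : R) : `|h| <= `|1 : R| -> exists2 s, 0 < s &
    eball (x + h *: v) s `<=` eball x r.
  by move=> /inB /nbhs_eball /nbhs_eballP.
set p := \sum_i _; set q := qform _ _.
pose dk (h : R) := \sum_i v 0 i * partial i u (x + h *: v) - p - h * q.
pose ddk (h : R) := qform (hessian u (x + h *: v)) v - q.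
have d1 (h : R) : `|h| <= `|1 : R| ->
    is_derive h 1 (fun h : R => u (x + h *: v) - u x - h * p - h ^+ 2 / 2 * q)
      (dk h).
  move=> h1; have [s s0 sB] := sub h h1.
  have D : is_derive (x + h *: v) v u
      (\sum_i v 0 i * partial i u (x + h *: v)).
    apply: (is_derive_along v s0).
      by move=> y i /sB /u2 [_ H _]; case: (H i).
    by move=> i; have [_ H _] := u2 _ (inB h h1); case: (H i).
  have L := is_derive_line (@ex_derive _ _ _ _ _ _ _ D).
  rewrite (@derive_val _ _ _ _ _ _ _ D) in L.
  apply: is_derive_eq; rewrite /dk /GRing.scale/=.
  by rewrite !mulr0 !add0r subr0; field.
have d2 (h : R) : `|h| <= `|1 : R| -> is_derive h 1 dk (ddk h).
  move=> h1; have [s s0 sB] := sub h h1.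
  have D j : is_derive h 1 (fun h : R => partial j u (x + h *: v))
      (\sum_i v 0 i * partial i (partial j u) (x + h *: v)).
    have D : is_derive (x + h *: v) v (partial j u)
        (\sum_i v 0 i * partial i (partial j u) (x + h *: v)).
      apply: (is_derive_along v s0).
        by move=> y i /sB /u2 [_ _ H]; case: (H i j).
      by move=> i; have [_ _ H] := u2 _ (inB h h1); case: (H i j).
    have L := is_derive_line (@ex_derive _ _ _ _ _ _ _ D).
    by rewrite (@derive_val _ _ _ _ _ _ _ D) in L.
  have DS : is_derive h 1 (\sum_i (fun h : R => v 0 i * partial i u (x + h *: v)))
      (\sum_j v 0 j * (\sum_i v 0 i * partial i (partial j u) (x + h *: v))).
    by apply: is_derive_sum => j; exact: is_deriveZ.
  have -> : dk = (fun h => (\sum_i (fun h : R =>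
      v 0 i * partial i u (x + h *: v))) h - p - h * q).
    by apply/funext => s'; rewrite /dk fct_sumE.
  apply: is_derive_eq; rewrite /ddk /GRing.scale/= !mulr1 !subr0.
  congr (_ - _); rewrite ?mulr0 ?add0r//.
  rewrite /bform exchange_big/=; apply: eq_bigr => j _; rewrite mulr_sumr.
  by apply: eq_bigr => i _; rewrite mxE; ring.
have bdd (h : R) : `|h| <= `|1 : R| -> `|ddk h| <= eta * l2norm v ^+ 2.
  move=> h1; rewrite /ddk /q -bformBM; apply: (le_trans (qform_le_l2norm _ _)).
  by rewrite ler_wpM2r ?exprn_ge0 ?l2norm_ge0//; exact: Hu (inB h h1).
have [c c1] := MVT_abs d1.
rewrite scale1r scale0r addr0 subrr !mul0r expr0n/= !mul0r !subr0 mul1r.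
rewrite expr1n mul1r mulr1 => ->.
have d2' (s : R) : `|s| <= `|c| -> is_derive s 1 dk (ddk s).
  by move=> sc; apply: d2; exact: le_trans sc c1.
have [c' c'c] := MVT_abs d2'.
have -> : dk 0 = 0 by rewrite /dk scale0r addr0 subrr mul0r subr0.
rewrite subr0 => ->; rewrite normrM.
have := bdd c' (le_trans c'c c1); rewrite normr1 in c1 *.
by move=> H; apply: le_trans H; rewrite ler_piMr.
Qed.

Definition mixed_diff (R : realType) n (u : 'rV[R]_n -> R) (i j : 'I_n)
    (s : R) (x : 'rV[R]_n) : R :=
  u (x + s *: delta_mx 0 i + s *: delta_mx 0 j) - u (x + s *: delta_mx 0 j)
  - u (x + s *: delta_mx 0 i) + u x.

(** Mixed differences along two coordinate axes reach the Hessian entry by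
    entry, whereas second differences in one direction only give its quadratic
    form. *)
Lemma mixed_diff_hessian (R : realType) n (u : 'rV[R]_n -> R) (x : 'rV[R]_n)
    (r s : R) i j :
  C2 (eball x r) u -> 0 <= s -> s *+ 2 < r ->
  exists2 z, l2norm (z - x) <= s *+ 2 &
    mixed_diff u i j s x = s ^+ 2 * hessian u z i j.
Proof.
move=> u2 s0 sr.
have nrm a b : `|a| <= s -> `|b| <= s ->
    l2norm (x + a *: delta_mx 0 i + b *: delta_mx 0 j - x) <= s *+ 2.
  move=> As Bs; have -> : x + a *: delta_mx 0 i + b *: delta_mx 0 j - x
     = a *: delta_mx 0 i + b *: delta_mx 0 j by rewrite -(addrA x) addrAC subrr add0r.
  apply: (le_trans (l2normD _ _)); rewrite !l2normZ !l2norm_delta !mulr1.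
  by rewrite mulr2n lerD.
have ball a b : `|a| <= s -> `|b| <= s ->
    eball x r (x + a *: delta_mx 0 i + b *: delta_mx 0 j).
  by move=> As Bs; exact: le_lt_trans (nrm a b As Bs) sr.
have ss : `|s| <= s by rewrite ger0_norm.
have [|c cs E] := @MVT_abs R
    (fun t => u (x + s *: delta_mx 0 i + t *: delta_mx 0 j)
            - u (x + t *: delta_mx 0 j))
    (fun t => partial j u (x + s *: delta_mx 0 i + t *: delta_mx 0 j)
            - partial j u (x + t *: delta_mx 0 j)) s.
  move=> t ts; have ts' : `|t| <= s by rewrite (le_trans ts).
  have [_ H1 _] := u2 _ (ball s t ss ts').
  have z0 : `|0 : R| <= s by rewrite normr0.
  have := ball 0 t z0 ts'; rewrite scale0r addr0 => /u2 [_ H2 _].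
  have [/is_derive_line L1 _] := H1 j; have [/is_derive_line L2 _] := H2 j.
  exact: is_deriveB.
have cs' : `|c| <= s by rewrite (le_trans cs).
have [|d ds E'] := @MVT_abs R
    (fun t => partial j u (x + c *: delta_mx 0 j + t *: delta_mx 0 i))
    (fun t => partial i (partial j u)
       (x + c *: delta_mx 0 j + t *: delta_mx 0 i)) s.
  move=> t ts; have ts' : `|t| <= s by rewrite (le_trans ts).
  have := ball t c ts' cs'; rewrite addrAC => /u2 [_ _ H].
  by have [/is_derive_line] := H i j.
have ds' : `|d| <= s by rewrite (le_trans ds).
exists (x + c *: delta_mx 0 j + d *: delta_mx 0 i).
  by have := nrm d c ds' cs'; rewrite [x + d *: _ + _]addrAC.
rewrite mxE; rewrite !scale0r !addr0 in E; rewrite !scale0r !addr0 in E'.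
rewrite [x + c *: _ + s *: _]addrAC in E'.
rewrite /mixed_diff; rewrite E' in E; move: E; rewrite expr2.
set a1 := u _; set a2 := u _; set a3 := u _ ; set a4 := u x; set a5 := partial _ _ _.
by move=> E; lra.
Qed.

(** * Quadratic polynomials and affine changes of variables *)

Definition quad (R : realType) n (a : R) (b : 'rV[R]_n) (A : 'M[R]_n)
    (z : 'rV[R]_n) : R :=
  a + \sum_i b 0 i * z 0 i + 2^-1 * qform A z.

(** This shape is stable under partial derivatives, so that first and second
    derivatives are both read off from [is_derive_pullback]. With [s := 1] it
    adds a quadratic polynomial to [f]; without polynomial it is a dilation. *)
Definition pullback (R : realType) n (k s : R) (x0 : 'rV[R]_n)
    (f : 'rV[R]_n -> R) a b A (z : 'rV[R]_n) : R :=
  k * f (s *: (z - x0)) + quad a b A (z - x0).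

Lemma is_derive_lineE (R : realType) n (f : 'rV[R]_n -> R) (z e : 'rV[R]_n)
    (d : R) :
  is_derive (0 : R) 1 (fun h : R => f (z + h *: e)) d -> is_derive z e f d.
Proof.
have E : (fun h : R => h^-1 *: (((fun k : R => f (z + k *: e)) \o shift (0 : R))
      (h *: (1 : R)) - f (z + 0 *: e)))
    = (fun h => h^-1 *: ((f \o shift z) (h *: e) - f z)).
  apply/funext => h /=; congr (_ *: (f _ - f _)).
    by rewrite [h *: 1]mulr1 addr0 addrC.
  by rewrite scale0r addr0.
move=> [D1 D2]; apply: DeriveDef.
  by move: D1; rewrite /derivable E.
by move: D2; rewrite /derive E.
Qed.

Lemma quadD (R : realType) n a b (A : 'M[R]_n) (z w : 'rV[R]_n) : A^T = A ->
  quad a b A (z + w)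
    = quad a b A z + \sum_i b 0 i * w 0 i + bform A w z + 2^-1 * qform A w.
Proof.
move=> AT; rewrite /quad !bformDl !bformDr.
rewrite -[in bform A z w]AT bformT.
rewrite (eq_bigr (fun i => b 0 i * z 0 i + b 0 i * w 0 i)); last first.
  by move=> i _; rewrite mxE mulrDr.
by rewrite big_split/=; field.
Qed.

Lemma sum_delta (R : realType) n (b : 'rV[R]_n) i :
  \sum_j b 0 j * (delta_mx 0 i : 'rV[R]_n) 0 j = b 0 i.
Proof.
rewrite (bigD1 i)//= mxE !eqxx mulr1 big1 ?addr0// => j ji.
by rewrite mxE (negbTE ji) mulr0.
Qed.

Lemma bform0M (R : realType) n (v w : 'rV[R]_n) : bform 0 v w = 0.
Proof. by rewrite -bformE mulmx0 mul0mx mxE. Qed.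

Lemma quad0 (R : realType) n a (z : 'rV[R]_n) : quad a 0 0 z = a.
Proof.
rewrite /quad bform0M mulr0 addr0 big1 ?addr0// => i _.
by rewrite mxE mul0r.
Qed.

Lemma bform_row (R : realType) n (A : 'M[R]_n) i (z : 'rV[R]_n) :
  bform A (delta_mx 0 i) z = \sum_j row i A 0 j * z 0 j.
Proof. by rewrite -bformE -rowE mxE; apply: eq_bigr => j _; rewrite !mxE. Qed.

Lemma quad_line (R : realType) n a b (A : 'M[R]_n) i (z : 'rV[R]_n) h :
  A^T = A ->
  quad a b A (z + h *: delta_mx 0 i)
  = quad a b A z + h * quad (b 0 i) (row i A) 0 z + h ^+ 2 * (2^-1 * A i i).
Proof.
move=> AT; rewrite (quadD _ _ _ _ AT) !bformZl bformZr bform_row bform_delta.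
rewrite /quad bform0M.
have -> : \sum_j b 0 j * (h *: delta_mx 0 i : 'rV[R]_n) 0 j = h * b 0 i.
  rewrite -[in RHS](sum_delta b i) mulr_sumr; apply: eq_bigr => j _.
  by rewrite mxE mulrCA.
by field.
Qed.

Lemma quad_translate (R : realType) n a b (A : 'M[R]_n) (c : 'rV[R]_n) :
  A^T = A -> exists a' b', forall z, quad a b A (z + c) = quad a' b' A z.
Proof.
move=> AT.
exists (a + \sum_i b 0 i * c 0 i + 2^-1 * qform A c), (b + c *m A) => z.
rewrite (quadD _ _ _ _ AT) /quad.
rewrite [X in _ = _ + X + _](eq_bigr
  (fun i => b 0 i * z 0 i + (c *m A) 0 i * z 0 i)); last first.
  by move=> i _; rewrite mxE mulrDl.
rewrite big_split/=.
have -> : \sum_i (c *m A) 0 i * z 0 i = bform A c z.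
  by rewrite -bformE mxE; apply: eq_bigr => i _; rewrite [z^T _ _]mxE.
by ring.
Qed.

Lemma quad_scale (R : realType) n a b (A : 'M[R]_n) s (z : 'rV[R]_n) :
  quad a b A (s *: z) = quad a (s *: b) (s ^+ 2 *: A) z.
Proof.
rewrite /quad bformZM bformZl bformZr; congr (_ + _ + _); last by ring.
by apply: eq_bigr => i _; rewrite !mxE; ring.
Qed.

Lemma quad_lin (R : realType) n (k : R) a b (A : 'M[R]_n) a' b' (A' : 'M[R]_n)
    (z : 'rV[R]_n) :
  quad a b A z + k * quad a' b' A' z
    = quad (a + k * a') (b + k *: b') (A + k *: A') z.
Proof.
rewrite /quad bformDM bformZM.
rewrite [X in _ = _ + X + _](eq_bigr
  (fun i => b 0 i * z 0 i + k * (b' 0 i * z 0 i))); last first.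
  by move=> i _; rewrite !mxE; ring.
by rewrite big_split/= -mulr_sumr; ring.
Qed.

Lemma mixed_diff_quad (R : realType) n a b (A : 'M[R]_n) (x : 'rV[R]_n) i j s :
  A^T = A -> mixed_diff (quad a b A) i j s x = s ^+ 2 * A i j.
Proof.
move=> AT; rewrite /mixed_diff -(addrA x) !(quadD _ _ _ _ AT).
have -> : bform A (s *: delta_mx 0 i + s *: delta_mx 0 j) x
   = bform A (s *: delta_mx 0 i) x + bform A (s *: delta_mx 0 j) x.
  by rewrite bformDl.
have -> : qform A (s *: delta_mx 0 i + s *: delta_mx 0 j)
   = qform A (s *: delta_mx 0 i) + qform A (s *: delta_mx 0 j)
     + (s ^+ 2 * A i j) *+ 2.
  rewrite !(bformDl, bformDr, bformZl, bformZr) !bform_delta.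
  have -> : A j i = A i j by rewrite -[in LHS]AT mxE.
  by rewrite mulr2n; ring.
have -> : \sum_k b 0 k * (s *: delta_mx 0 i + s *: delta_mx 0 j : 'rV_n) 0 k
   = \sum_k b 0 k * (s *: delta_mx 0 i : 'rV_n) 0 k
   + \sum_k b 0 k * (s *: delta_mx 0 j : 'rV_n) 0 k.
  by rewrite -big_split/=; apply: eq_bigr => k _; rewrite mxE mulrDr.
by field.
Qed.

Lemma continuous_sumf (R : realType) n (I : finType) (F : I -> 'rV[R]_n -> R)
    (x : 'rV[R]_n) :
  (forall i, {for x, continuous (F i)}) ->
  {for x, continuous (fun z => \sum_i F i z)}.
Proof.
move=> cF.
have -> : (fun z => \sum_i F i z) = \sum_i F i.
  by apply/funext => z; rewrite fct_sumE.
elim/big_ind : _ => [|f g cf cg|i _]; [exact: cst_continuous| |exact: cF].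
exact: continuousD.
Qed.

Lemma continuousDf (R : realType) n (f g : 'rV[R]_n -> R) (x : 'rV[R]_n) :
  {for x, continuous f} -> {for x, continuous g} ->
  {for x, continuous (fun z => f z + g z)}.
Proof. exact: continuousD. Qed.

Lemma continuousMf (R : realType) n (f g : 'rV[R]_n -> R) (x : 'rV[R]_n) :
  {for x, continuous f} -> {for x, continuous g} ->
  {for x, continuous (fun z => f z * g z)}.
Proof. exact: continuousM. Qed.

Lemma continuousBf (R : realType) n (f g : 'rV[R]_n -> R) (x : 'rV[R]_n) :
  {for x, continuous f} -> {for x, continuous g} ->
  {for x, continuous (fun z => f z - g z)}.
Proof. exact: continuousB. Qed.

Lemma continuous_quad (R : realType) n a b (A : 'M[R]_n) (z : 'rV[R]_n) :
  {for z, continuous (quad a b A)}.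
Proof.
have cc i : {for z, continuous (fun w : 'rV[R]_n => w 0 i)}.
  exact: coord_continuous.
apply: continuousDf.
  apply: continuousDf; first exact: cst_continuous.
  apply: continuous_sumf => i; apply: continuousMf => //.
  exact: cst_continuous.
apply: continuousMf; first exact: cst_continuous.
apply: continuous_sumf => i; apply: continuous_sumf => j.
apply: continuousMf => //; apply: continuousMf => //.
exact: cst_continuous.
Qed.

Lemma continuous_affine (R : realType) n s (x0 z : 'rV[R]_n) :
  {for z, continuous (fun z : 'rV[R]_n => s *: (z - x0))}.
Proof.
apply: (@continuous_comp _ _ _ (fun z : 'rV[R]_n => z - x0) ( *:%R s)).
  by apply: continuousB; [exact: id|exact: cst_continuous].
exact: scaler_continuous.
Qed.

Lemma continuous_comp_affine (R : realType) n s (x0 z : 'rV[R]_n)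
    (f : 'rV[R]_n -> R) :
  {for s *: (z - x0), continuous f} ->
  {for z, continuous (fun z : 'rV[R]_n => f (s *: (z - x0)))}.
Proof.
move=> /continuous_eballP cf; apply/continuous_eballP => e /cf[d d0 dP].
have s0 : 0 < `|s| + 1 by rewrite ltr_wpDl.
exists (d / (`|s| + 1)); first by rewrite divr_gt0.
move=> y; rewrite /eball/= ltr_pdivlMr// => yz; apply: dP.
rewrite /eball/= -scalerBr opprB addrA subrK l2normZ mulrC.
by apply: le_lt_trans yz; rewrite ler_wpM2l ?l2norm_ge0// lerDl.
Qed.

Lemma continuous_pullback (R : realType) n k s (x0 : 'rV[R]_n) f a b A z :
  {for s *: (z - x0), continuous f} ->
  {for z, continuous (pullback k s x0 f a b A)}.
Proof.
move=> cf; apply: continuousDf.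
  apply: continuousMf; first exact: cst_continuous.
  exact: continuous_comp_affine.
apply: (@continuous_comp _ _ _ (fun z : 'rV[R]_n => z - x0)).
  by apply: continuousB; [exact: id|exact: cst_continuous].
exact: continuous_quad.
Qed.

Lemma is_derive_pullback (R : realType) n k s (x0 : 'rV[R]_n) f a b
    (A : 'M[R]_n) z i : A^T = A ->
  derivable f (s *: (z - x0)) (delta_mx 0 i) ->
  is_derive z (delta_mx 0 i) (pullback k s x0 f a b A)
    (pullback (k * s) s x0 (partial i f) (b 0 i) (row i A) 0 z).
Proof.
move=> AT df; apply: is_derive_lineE.
have L : is_derive (s * 0) 1 (fun h : R => f (s *: (z - x0) + h *: delta_mx 0 i))
    (partial i f (s *: (z - x0))).
  have := @is_derive_line R n f (s *: (z - x0)) (delta_mx 0 i) (s * 0).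
  by rewrite mulr0 scale0r addr0; apply.
have Ls : is_derive (0 : R) 1 (fun h => s * h) s.
  by apply: is_derive_eq; rewrite [_ *: _]mulr1 ?scaler0 ?addr0.
have C := @is_derive1_comp R _ (fun h => s * h) (0 : R) _ _ L Ls.
have -> : (fun h : R => pullback k s x0 f a b A (z + h *: delta_mx 0 i))
    = (fun h => k * ((fun h : R => f (s *: (z - x0) + h *: delta_mx 0 i))
         \o (fun h => s * h)) h
       + (quad a b A (z - x0)
          + h * quad (b 0 i) (row i A) 0 (z - x0) + h ^+ 2 * (2^-1 * A i i))).
  apply/funext => h; rewrite /pullback addrAC -quad_line//=; congr (_ * f _ + _).
  by rewrite scalerDr scalerA.
move: C; set g := (_ \o _) => C.
apply: is_derive_eq; rewrite /pullback /GRing.scale/=; ring.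
Qed.

Lemma near_eq_continuous (R : realType) n (f g : 'rV[R]_n -> R) x :
  (\near x, f x = g x) -> {for x, continuous f} -> {for x, continuous g}.
Proof.
move=> E cf; have Ex := nbhs_singleton E.
move: cf; rewrite /prop_for /continuous_at Ex => cf.
exact: cvg_trans (near_eq_cvg E) cf.
Qed.

Section pullback_C2.
Context (R : realType) (n : nat) (k s : R) (x0 : 'rV[R]_n).
Context (f : 'rV[R]_n -> R) (a : R) (b : 'rV[R]_n) (A : 'M[R]_n).
Context (V : set 'rV[R]_n).
Hypothesis AT : A^T = A.
Hypothesis Vo : open V.
Hypothesis f2 : C2 V f.

Let W := (fun z : 'rV[R]_n => s *: (z - x0)) @^-1` V.

Lemma open_affine_preimage : open W.
Proof.
by apply: open_comp => // z _; exact: continuous_affine.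
Qed.

Lemma partial_pullback z i : W z ->
  partial i (pullback k s x0 f a b A) z
    = pullback (k * s) s x0 (partial i f) (b 0 i) (row i A) 0 z.
Proof.
move=> Wz; have [_ H _] := f2 Wz.
exact: (@derive_val _ _ _ _ _ _ _ (is_derive_pullback _ _ _ AT (H i).1)).
Qed.

Let near_partial z j : W z ->
  \near z, pullback (k * s) s x0 (partial j f) (b 0 j) (row j A) 0 z
    = partial j (pullback k s x0 f a b A) z.
Proof.
move=> Wz; have : nbhs z W.
  by apply: open_nbhs_nbhs; split=> //; exact: open_affine_preimage.
by apply: filterS => w Ww; rewrite partial_pullback.
Qed.

Let is_derive_partial z i j : W z ->
  is_derive z (delta_mx 0 i) (partial j (pullback k s x0 f a b A))
    (pullback (k * s * s) s x0 (partial i (partial j f)) (row j A 0 i) 0 0 z).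
Proof.
move=> Wz; apply: near_eq_is_derive (near_partial j Wz) _.
have [_ _ H] := f2 Wz.
have := is_derive_pullback (k * s) (b 0 j) (row j A) (trmx0 _ _ _) (H i j).1.
by rewrite row0; apply.
Qed.

Lemma hessian_pullback z : W z ->
  hessian (pullback k s x0 f a b A) z
    = (k * s ^+ 2) *: hessian f (s *: (z - x0)) + A.
Proof.
move=> Wz; apply/matrixP => i j; rewrite !mxE.
rewrite [LHS](@derive_val _ _ _ _ _ _ _ (is_derive_partial i j Wz)).
rewrite /pullback quad0 mxE -[in A j i]AT mxE; congr (_ + _).
by rewrite expr2 mulrA.
Qed.

Lemma C2_pullback : C2 W (pullback k s x0 f a b A).
Proof.
move=> z Wz; have [H0 H1 H2] := f2 Wz; split.
- exact: continuous_pullback.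
- move=> i; split.
    exact: (@ex_derive _ _ _ _ _ _ _ (is_derive_pullback _ _ _ AT (H1 i).1)).
  apply: near_eq_continuous (near_partial i Wz) _.
  exact: continuous_pullback (H1 i).2.
- move=> i j; split.
    exact: (@ex_derive _ _ _ _ _ _ _ (is_derive_partial i j Wz)).
  have nW : nbhs z W.
    by apply: open_nbhs_nbhs; split=> //; exact: open_affine_preimage.
  have E : \near z,
      pullback (k * s * s) s x0 (partial i (partial j f)) (row j A 0 i) 0 0 z
      = partial i (partial j (pullback k s x0 f a b A)) z.
    apply: filterS nW => w Ww.
    by rewrite [RHS](@derive_val _ _ _ _ _ _ _ (is_derive_partial i j Ww)).
  apply: near_eq_continuous E _.
  exact: continuous_pullback (H2 i j).2.
Qed.

End pullback_C2.

(** * Uniformly elliptic functions *)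

Lemma symMD (R : realType) n (A B : symM R n) :
  symM_val (A + B) = symM_val A + symM_val B.
Proof. by []. Qed.

Lemma symMN (R : realType) n (A : symM R n) : symM_val (- A) = - symM_val A.
Proof. by []. Qed.

Lemma symMZ (R : realType) n (k : R) (A : symM R n) :
  symM_val (k *: A) = k *: symM_val A.
Proof. by []. Qed.

Lemma symM_inj (R : realType) n (A B : symM R n) : A = B :> 'M[R]_n -> A = B.
Proof. exact: val_inj. Qed.

Lemma symM_tr (R : realType) n (A : symM R n) : (A : 'M[R]_n)^T = A.
Proof. by have := symM_valP A; rewrite inE => /eqP. Qed.

Lemma sympart_sym (R : realType) n (M : 'M[R]_n) : M^T = M -> sympart M = M :> 'M[R]_n.
Proof.
move=> MT; rewrite /sympart/= MT scalerDr -scalerDl.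
by rewrite (_ : 2^-1 + 2^-1 = 1) ?scale1r//; apply: (@mulIf _ 2); rewrite ?pnatr_eq0//; field.
Qed.

Definition idS (R : realType) n : symM R n := sympart 1%:M.

Lemma idSZE (R : realType) n (k : R) : symM_val (k *: idS R n) = k%:M.
Proof. by rewrite symMZ sympart_sym ?trmx1// scalemx1. Qed.

Lemma psdE (R : realType) n (N : symM R n) : psd N <-> forall v, 0 <= qform N v.
Proof. by split=> H v; have := H v; rewrite bformE. Qed.

Lemma psd_idS (R : realType) n (k : R) : 0 <= k -> psd (k *: idS R n).
Proof.
move=> k0; apply/psdE => v.
by rewrite idSZE qform_scalar mulr_ge0// exprn_ge0// l2norm_ge0.
Qed.

Lemma psd_sub_idS (R : realType) n (k : R) (D : symM R n) :
  (forall v, qform D v <= k * l2norm v ^+ 2) -> psd (k *: idS R n - D).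
Proof.
move=> H; apply/psdE => v.
by rewrite symMD symMN bformBM idSZE qform_scalar subr_ge0.
Qed.

Lemma tr_idS (R : realType) n (k : R) : \tr (k *: idS R n : symM R n) = k * n%:R.
Proof. by rewrite idSZE mxtrace_scalar mulr_natr. Qed.

Lemma psd_diag (R : realType) n (N : symM R n) i : psd N -> 0 <= (N : 'M[R]_n) i i.
Proof. by move=> /psdE/(_ (delta_mx 0 i)); rewrite bform_delta. Qed.

Lemma psd_tr_ge0 (R : realType) n (N : symM R n) : psd N -> 0 <= \tr N.
Proof. by move=> N0; apply: sumr_ge0 => i _; exact: psd_diag. Qed.

Lemma psd_entry_le_tr (R : realType) n (N : symM R n) i j :
  psd N -> `|(N : 'M[R]_n) i j| <= \tr N.
Proof.
move=> N0.
have D k : (N : 'M[R]_n) k k <= \tr N.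
  rewrite /mxtrace (bigD1 k)//= lerDl sumr_ge0// => l _; exact: psd_diag.
have Nji : (N : 'M[R]_n) j i = (N : 'M[R]_n) i j by rewrite -[in LHS]symM_tr mxE.
have /psdE P := N0.
have := P (delta_mx 0 i + delta_mx 0 j); have := P (delta_mx 0 i - delta_mx 0 j).
rewrite -scaleN1r !(bformDl, bformDr, bformZl, bformZr) !bform_delta Nji.
have := D i; have := D j => Dj Di H1 H2.
rewrite ler_norml; apply/andP; split; lra.
Qed.

(** A crude substitute for bounding the largest eigenvalue by the trace. *)
Lemma psd_qform_le_tr (R : realType) n (N : symM R n) (e : 'rV[R]_n) :
  psd N -> l2norm e <= 1 -> qform N e <= (n * n)%:R * \tr N.
Proof.
move=> N0 e1; rewrite /bform pair_bigA/=.
apply: (@le_trans _ _ (\sum_(p : 'I_n * 'I_n) \tr N)); last first.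
  by rewrite sumr_const card_prod !card_ord mulr_natl.
apply: ler_sum => p _; apply: le_trans (ler_norm _) _.
have c i : `|e 0 i| <= 1 by rewrite (le_trans (coord_le_l2norm _ _ _)).
rewrite !normrM; apply: le_trans (psd_entry_le_tr p.1 p.2 N0).
apply: le_trans (ler_piMr _ (c p.2)) _; first by rewrite mulr_ge0.
by rewrite ler_piMl.
Qed.

Definition unif_elliptic (R : realType) n (lam Lam : R) (G : symM R n -> R) :=
  forall M N : symM R n, psd N -> lam * \tr N <= G (M + N) - G M <= Lam * \tr N.

Definition dual (R : realType) n (G : symM R n -> R) : symM R n -> R :=
  fun M => - G (- M).

Section elliptic_theory.
Context (R : realType) (n : nat) (lam Lam : R).
Hypothesis lam0 : 0 < lam.
Implicit Types (G : symM R n -> R) (M N D : symM R n).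

Lemma unif_elliptic_dual G :
  unif_elliptic lam Lam G -> unif_elliptic lam Lam (dual G).
Proof.
move=> GE M N N0; rewrite /dual opprK addrC.
by have := GE (- (M + N)) N N0; rewrite opprD addrNK.
Qed.

(** Both [M] and [M + D] are compared with [M + k I], which exceeds [M + D] by
    the positive semidefinite matrix [k I - D]. *)
Lemma elliptic_gap G M D k : unif_elliptic lam Lam G -> 0 <= k ->
  psd (k *: idS R n - D) ->
  G (M + D) + lam * \tr (k *: idS R n - D : symM R n) <= G M + Lam * (k * n%:R).
Proof.
move=> GE k0 P.
have /andP[+ _] := GE (M + D) _ P.
have /andP[_ +] := GE M _ (@psd_idS R n _ k0).
by rewrite tr_idS -addrA [D + _]addrC subrK => H1 H2; lra.
Qed.

Lemma elliptic_le G M D k : unif_elliptic lam Lam G -> 0 <= k ->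
  (forall v, qform D v <= k * l2norm v ^+ 2) ->
  G (M + D) <= G M + Lam * (k * n%:R).
Proof.
move=> GE k0 /psd_sub_idS P; apply: le_trans (elliptic_gap M GE k0 P).
by rewrite lerDl mulr_ge0 ?psd_tr_ge0// ltW.
Qed.

(** Moving along multiples of the identity changes [G] at a rate between
    [lam * n] and [Lam * n], which puts a nearby matrix on the zero set. *)
Lemma elliptic_correction G A : (0 < n)%N -> unif_elliptic lam Lam G ->
  exists2 s : R, `|s| <= `|G A| / (lam * n%:R) & G (A + s *: idS R n) = 0.
Proof.
move=> n0 GE.
have ln0 : 0 < lam * n%:R by rewrite mulr_gt0// ltr0n.
pose f (s : R) := G (A + s *: idS R n).
have incr s d : 0 <= d ->
    d * (lam * n%:R) <= f (s + d) - f s <= Lam * (d * n%:R).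
  move=> d0; have := GE (A + s *: idS R n) _ (@psd_idS R n _ d0).
  by rewrite tr_idS -addrA -scalerDl mulrCA.
pose K := `|Lam| * n%:R.
have K0 : 0 <= K by rewrite mulr_ge0.
have lipd s d : 0 <= d -> `|f (s + d) - f s| <= K * d.
  move=> d0; have /andP[H1 H2] := incr s d d0.
  rewrite ger0_norm; last by apply: le_trans H1; rewrite mulr_ge0// ltW.
  by rewrite (le_trans H2)// /K -mulrA [n%:R * d]mulrC ler_wpM2r ?mulr_ge0// ler_norm.
have lip s t : `|f s - f t| <= K * `|s - t|.
  have [st|ts] := leP s t.
    have := lipd s (t - s); rewrite subr_ge0 => /(_ st).
    rewrite (_ : s + (t - s) = t); last by ring.
    by rewrite distrC (distrC s) (ger0_norm (_ : 0 <= t - s)) ?subr_ge0.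
  have := lipd t (s - t); rewrite subr_ge0 => /(_ (ltW ts)); move: ts => /ltW ts.
  rewrite (_ : t + (s - t) = s); last by ring.
  by rewrite (ger0_norm (_ : 0 <= s - t)) ?subr_ge0.
have cf : continuous f.
  move=> s; apply/cvgrPdist_lt => e e0.
  have q0 : 0 < e / (K + 1) by rewrite divr_gt0// ltr_wpDl.
  near=> t; apply: le_lt_trans (lip s t) _.
  have : `|s - t| < e / (K + 1).
    by near: t; apply/nbhs_ballP; exists (e / (K + 1)).
  rewrite ltr_pdivlMr ?ltr_wpDl// => H; apply: le_lt_trans H.
  by rewrite mulrC ler_wpM2l// lerDl.
pose s0 := `|G A| / (lam * n%:R).
have s00 : 0 <= s0 by rewrite divr_ge0// ltW.
have f0 : f 0 = G A by rewrite /f scale0r addr0.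
have E : s0 * (lam * n%:R) = `|G A| by rewrite /s0 divfK// gt_eqF.
have fp : 0 <= f s0.
  have /andP[+ _] := incr 0 s0 s00; rewrite add0r f0 E => H.
  by have := ler_norm (- G A); rewrite normrN; lra.
have fm : f (- s0) <= 0.
  have /andP[+ _] := incr (- s0) s0 s00; rewrite addNr f0 E => H.
  by have := ler_norm (G A); lra.
have [|||c cin fc] := @IVT R f (- s0) s0 0.
- by rewrite ge0_cp.
- exact: continuous_subspaceT.
- by rewrite ge_min fm/= le_max fp orbT.
exists c => //; move: cin; rewrite in_itv/= => /andP[c1 c2].
by rewrite ler_norml c1 c2.
Unshelve. all: by end_near. Qed.

End elliptic_theory.

(** * Viscosity solutions: one-sided formulation and rescaling *)

(** Touching from below by a solution of [G] is touching from above for [- u] and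
    [dual G], so every argument about solutions is made once, for [subsol]. *)
Definition subsol (R : realType) n (G : symM R n -> R) (Omega : set 'rV[R]_n)
    (u : 'rV[R]_n -> R) : Prop :=
  forall x V phi, Omega x -> open_nbhs x V -> C2 V phi ->
    touches_above phi u x -> 0 <= G (sympart (hessian phi x)).

Lemma sympartD (R : realType) n (M N : 'M[R]_n) :
  sympart (M + N) = sympart M + sympart N.
Proof.
by apply: symM_inj; rewrite symMD; apply/matrixP => i j; rewrite !mxE; ring.
Qed.

Lemma sympartZ (R : realType) n (k : R) (M : 'M[R]_n) :
  sympart (k *: M) = k *: sympart M.
Proof.
by apply: symM_inj; rewrite symMZ; apply/matrixP => i j; rewrite !mxE; ring.
Qed.

Lemma sympartN (R : realType) n (M : 'M[R]_n) : sympart (- M) = - sympart M.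
Proof. by rewrite -scaleN1r sympartZ scaleN1r. Qed.

Lemma sympart_id (R : realType) n (A : symM R n) : sympart A = A.
Proof. by apply: symM_inj; rewrite sympart_sym// symM_tr. Qed.

Lemma C2_opp (R : realType) n (V : set 'rV[R]_n) phi : open V -> C2 V phi ->
  C2 V (fun x => - phi x) /\
  forall x, V x -> hessian (fun x => - phi x) x = - hessian phi x.
Proof.
move=> Vo phi2.
have E : (fun x => - phi x) = pullback (-1) 1 0 phi 0 0 0.
  by apply/funext => x; rewrite /pullback quad0 addr0 mulN1r scale1r subr0.
have VE : V = (fun z : 'rV[R]_n => 1 *: (z - 0)) @^-1` V.
  by apply/funext => x /=; rewrite scale1r subr0.
rewrite E; split.
  by rewrite [X in C2 X]VE; apply: C2_pullback => //; exact: trmx0.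
move=> x Vx; rewrite (hessian_pullback _ _ _ (trmx0 _ _ _) Vo phi2).
  by rewrite subr0 expr1n mulr1 scale1r scaleN1r addr0.
by rewrite -VE.
Qed.

Lemma visc_solE (R : realType) n (G : symM R n -> R) Omega u :
  visc_sol G Omega u <->
  [/\ forall x, Omega x -> {for x, continuous u}, subsol G Omega u
    & subsol (dual G) Omega (fun x => - u x)].
Proof.
split=> [[cu su Su]|[cu su Su]]; split=> //.
- move=> x V phi Ox xV phi2 [phix phiu]; rewrite /dual oppr_ge0.
  have [phi2' HE] := C2_opp xV.1 phi2.
  rewrite -sympartN -HE ?xV.2//; last exact: xV.2.
  apply: Su phi2' _ => //; split; first by rewrite phix opprK.
  by apply: filterS phiu => y; rewrite lerNl.
- move=> x V phi Ox xV phi2 [phix phiu].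
  have [phi2' HE] := C2_opp xV.1 phi2.
  have := Su x V _ Ox xV phi2'.
  rewrite HE; last exact: xV.2.
  rewrite /dual sympartN opprK oppr_ge0; apply; split; first by rewrite phix.
  by apply: filterS phiu => y; rewrite lerN2.
Qed.

(** Subtracting a polynomial that solves the equation and dilating turns a
    solution of [G] into a solution of a shifted and scaled operator. *)
Definition rescale (R : realType) n (c s : R) (x0 : 'rV[R]_n) a b (A : 'M[R]_n)
    (u : 'rV[R]_n -> R) (y : 'rV[R]_n) : R :=
  c * (u (x0 + s *: y) - quad a b A (s *: y)).

Lemma quadN (R : realType) n a b (A : 'M[R]_n) (z : 'rV[R]_n) :
  quad (- a) (- b) (- A) z = - quad a b A z.
Proof.
have := quad_lin (-1) 0 0 0 a b A z.
by rewrite quad0 !add0r !scaleN1r mulN1r mulN1r => ->.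
Qed.

Section rescaling.
Context (R : realType) (n : nat) (c s r : R) (x0 : 'rV[R]_n).
Hypothesis c0 : 0 < c.
Hypothesis s0 : 0 < s.

Lemma subsol_rescale (G : symM R n -> R) u a b (A : symM R n) : G A = 0 ->
  subsol G (eball x0 (s * r)) u ->
  subsol (shift_scale A (c * s ^+ 2) G) (eball 0 r) (rescale c s x0 a b A u).
Proof.
move=> GA su y V phi yr [Vo Vy] phi2 [phiy phiu].
have sn0 : s != 0 by rewrite gt_eqF.
have cn0 : c != 0 by rewrite gt_eqF.
pose x := x0 + s *: y.
have xB : x - x0 = s *: y by rewrite /x addrAC subrr add0r.
have xy : s^-1 *: (x - x0) = y.
  by rewrite xB scalerA mulVf// scale1r.
pose psi := pullback c^-1 s^-1 x0 phi a b A.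
pose W := (fun z : 'rV[R]_n => s^-1 *: (z - x0)) @^-1` V.
have Wx : W x by rewrite /W/= xy.
have AT := symM_tr A.
have Hpsi : hessian psi x = (c * s ^+ 2)^-1 *: hessian phi y + A.
  by rewrite (hessian_pullback c^-1 a b AT Vo phi2 Wx) xy invfM exprVn.
suff : 0 <= G (sympart (hessian psi x)).
  rewrite Hpsi sympartD sympartZ sympart_id /shift_scale GA subr0 => H.
  apply: mulr_ge0; first by rewrite ltW// mulr_gt0// exprn_gt0.
  by rewrite addrC.
apply: (su x W psi).
- move: yr; rewrite /eball/= subr0 => yr.
  by rewrite xB l2normZ gtr0_norm// ltr_pM2l.
- by split=> //; exact: open_affine_preimage.
- exact: C2_pullback.
split.
  rewrite /psi /pullback xy phiy /rescale mulrA mulVf// mul1r -/x.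
  by rewrite xB subrK.
have /nbhs_eballP[d d0 dP] := phiu; apply/nbhs_eballP.
exists (s * d) => [|z zx]; first by rewrite mulr_gt0.
have := dP (s^-1 *: (z - x0)); rewrite /= /rescale scalerA divff// scale1r.
have -> : x0 + (z - x0) = z by rewrite addrC subrK.
rewrite /psi /pullback => H.
rewrite -lerBlDr -(ler_pM2l c0) (mulrA c) divff// mul1r.
apply: H; rewrite /eball/= -xy -scalerBr opprB addrA subrK l2normZ.
by rewrite gtr0_norm ?invr_gt0// mulrC ltr_pdivrMr// mulrC.
Qed.

Lemma dual_shift_scale (G : symM R n -> R) (A : symM R n) t :
  dual (shift_scale A t G) = shift_scale (- A) t (dual G).
Proof.
apply/funext => M; rewrite /dual /shift_scale opprD opprK scalerN.
by ring.
Qed.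

Lemma visc_sol_rescale (G : symM R n -> R) u a b (A : symM R n) : G A = 0 ->
  visc_sol G (eball x0 (s * r)) u ->
  visc_sol (shift_scale A (c * s ^+ 2) G) (eball 0 r) (rescale c s x0 a b A u).
Proof.
move=> GA /visc_solE[cu su Su]; apply/visc_solE; split.
- move=> y yr.
  have : {for x0 + s *: y, continuous u}.
    apply: cu; move: yr; rewrite /eball/= subr0 => yr.
    by rewrite addrAC subrr add0r l2normZ gtr0_norm// ltr_pM2l.
  have E z : x0 + s *: z = s *: (z - (- (s^-1 *: x0))).
    by rewrite opprK scalerDr scalerA divff ?gt_eqF// scale1r addrC.
  rewrite E => /continuous_comp_affine cu'.
  apply: (@continuousMf _ _ (cst c)); first exact: cst_continuous.
  apply: (@continuousDf _ _ (fun y => u (x0 + s *: y))).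
    by rewrite (_ : (fun y => _) = (fun y => u (s *: (y - (- (s^-1 *: x0))))))//;
      apply/funext => z; rewrite E.
  have cq := @continuous_quad R n (- a) (- (s *: b)) (- (s ^+ 2 *: symM_val A)) y.
  rewrite (_ : (fun _ => _) = quad (- a) (- (s *: b)) (- (s ^+ 2 *: symM_val A)))//.
  by apply/funext => z; rewrite quadN quad_scale.
- exact: subsol_rescale.
- rewrite dual_shift_scale.
  have -> : (fun x => - rescale c s x0 a b A u x)
      = rescale c s x0 (- a) (- b) (- A : symM R n) (fun x => - u x).
    by apply/funext => z; rewrite /rescale symMN quadN; ring.
  apply: subsol_rescale => //.
  by rewrite /dual opprK GA oppr0.
Qed.

End rescaling.

(** * Interior Lipschitz estimate by doubling variables *)

Lemma l2norm_parallelogram (R : realType) n (a b : 'rV[R]_n) :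
  l2norm (a + b) ^+ 2 + l2norm (a - b) ^+ 2
    = 2 * l2norm a ^+ 2 + 2 * l2norm b ^+ 2.
Proof.
rewrite !sqr_l2norm_row !mulr_sumr -!big_split/=.
by apply: eq_bigr => i _; rewrite !mxE; ring.
Qed.

Lemma hessianE (R : realType) n (u : 'rV[R]_n -> R) x i j :
  hessian u x i j = partial i (partial j u) x.
Proof. by rewrite mxE. Qed.

Lemma mxBE (R : realType) m n (A B : 'M[R]_(m, n)) i j :
  (A - B) i j = A i j - B i j.
Proof. by rewrite !mxE. Qed.

Lemma continuous_mx_near (R : realType) n (H : 'rV[R]_n -> 'M[R]_n) x eta :
  0 < eta -> (forall i j, {for x, continuous (fun y => H y i j)}) ->
  exists2 t, 0 < t & forall y, eball x t y -> l2norm (H y - H x) <= eta.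
Proof.
move=> eta0 cH; pose k := eta / (n * n).+1%:R.
have k0 : 0 < k by rewrite divr_gt0.
have : nbhs x [set y | forall p : 'I_n * 'I_n,
    `|H x p.1 p.2 - H y p.1 p.2| < k].
  apply: (@filter_forall _ _ (fun p y => `|H x p.1 p.2 - H y p.1 p.2| < k)
    (nbhs x)) => p.
  have /continuous_eballP/(_ _ k0) C := cH p.1 p.2.
  exact/nbhs_eballP.
move=> /nbhs_eballP[d d0 dP]; exists d => // y yd.
apply: (@le_trans _ _ ((n * n)%:R * k)).
  apply: l2norm_le_entries => i j.
  by have := dP y yd (i, j); rewrite mxBE distrC => /ltW.
rewrite /k mulrC -mulrA ger_pMr// mulrC ler_pdivrMr// mul1r ler_nat.
exact: leqnSn.
Qed.

(** A second-order expansion at a point is all that the arguments at a maximum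
    use, so these are stated for abstract [p] and [X]. *)
Definition expansion (R : realType) n (u : 'rV[R]_n -> R) (x : 'rV[R]_n)
    (p : 'rV[R]_n) (X : 'M[R]_n) : Prop :=
  forall eta, 0 < eta -> exists2 t, 0 < t & forall v, l2norm v < t ->
    `|u (x + v) - u x - \sum_i v 0 i * p 0 i - 2^-1 * qform X v|
      <= eta * l2norm v ^+ 2.

Lemma C2_hessian_near (R : realType) n (V : set 'rV[R]_n) u x eta :
  open_nbhs x V -> C2 V u -> 0 < eta ->
  exists2 t, 0 < t & eball x t `<=` V /\
    forall y, eball x t y -> l2norm (hessian u y - hessian u x) <= eta.
Proof.
move=> xV u2 eta0; have [_ _ H] := u2 x xV.2.
have [i j|t t0 tP] := @continuous_mx_near _ _ (hessian u) x _ eta0.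
  rewrite (_ : (fun y => _) = partial i (partial j u)); first by case: (H i j).
  by apply/funext => y; rewrite hessianE.
have [r r0 rV] := eball_open_nbhs xV.
exists (Num.min t r); first by rewrite lt_min t0.
split=> y; rewrite /eball/= lt_min => /andP[yt yr]; first exact: rV.
exact: tP.
Qed.

Lemma C2_expansion (R : realType) n (V : set 'rV[R]_n) u x :
  open_nbhs x V -> C2 V u -> expansion u x (grad u x) (hessian u x).
Proof.
move=> xV u2 eta eta0.
have [t t0 [tV tP]] := C2_hessian_near xV u2 eta0.
exists t => // v vt.
rewrite (eq_bigr (fun i => v 0 i * partial i u x)); last first.
  by move=> i _; rewrite [grad _ _ _ _]mxE.
by apply: taylor2 vt => //; apply: C2_sub u2.
Qed.

Lemma second_difference (R : realType) n (u : 'rV[R]_n -> R) x p X xi eps :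
  expansion u x p X -> 0 < eps ->
  exists2 h0, 0 < h0 & forall h, 0 < h < h0 ->
    `|u (x + h *: xi) + u (x - h *: xi) - 2 * u x - h ^+ 2 * qform X xi|
      <= eps * h ^+ 2.
Proof.
move=> uX eps0; set q := l2norm xi.
have q0 : 0 <= q by exact: l2norm_ge0.
have q1 : 0 < 2 * (q ^+ 2 + 1) by rewrite mulr_gt0// ltr_wpDl// exprn_ge0.
pose eta := eps / (2 * (q ^+ 2 + 1)).
have eta0 : 0 < eta by rewrite divr_gt0.
have [t t0 tP] := uX eta eta0.
exists (t / (q + 1)); first by rewrite divr_gt0// ltr_wpDl.
move=> h /andP[h0]; rewrite ltr_pdivlMr ?ltr_wpDl// => ht.
have hq : `|h| * q < t.
  by rewrite gtr0_norm//; apply: le_lt_trans ht; rewrite ler_pM2l// lerDl.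
have := tP (h *: xi); rewrite l2normZ => /(_ hq) T1.
have := tP (- (h *: xi)); rewrite l2normN l2normZ => /(_ hq) T2.
have qN : qform X (- (h *: xi)) = h ^+ 2 * qform X xi.
  by rewrite -scaleN1r !(bformZl, bformZr); ring.
have qP : qform X (h *: xi) = h ^+ 2 * qform X xi.
  by rewrite bformZl bformZr; ring.
move: T1 T2; rewrite qN qP exprMn real_normK ?num_real//.
set p1 := \sum_i _; set p2 := \sum_i _; set Q := qform _ _.
have -> : p2 = - p1.
  by rewrite /p2 -sumrN; apply: eq_bigr => i _; rewrite !mxE mulNr.
have E : eta * (h ^+ 2 * q ^+ 2) *+ 2 <= eps * h ^+ 2.
  rewrite /eta; have -> : eps / (2 * (q ^+ 2 + 1)) * (h ^+ 2 * q ^+ 2) *+ 2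
      = (eps * h ^+ 2) * (q ^+ 2 / (q ^+ 2 + 1)).
    by rewrite mulr2n; field; rewrite gt_eqF// ltr_wpDl// exprn_ge0.
  rewrite ger_pMr ?mulr_gt0 ?exprn_gt0//.
  by rewrite ler_pdivrMr ?mul1r ?lerDl// ltr_wpDl// exprn_ge0.
move: E; rewrite mulr2n -/q; set k := eta * _; move=> E.
rewrite !ler_norml => /andP[A1 A2] /andP[B1 B2].
apply/andP; split; lra.
Qed.

Lemma max_second_order (R : realType) n (u : 'rV[R]_n -> R) x y p q X Y
    xi zeta K h0 : expansion u x p X -> expansion u y q Y -> 0 < h0 ->
  (forall h, 0 < h < h0 ->
    (u (x + h *: xi) + u (x - h *: xi) - 2 * u x)
    - (u (y + h *: zeta) + u (y - h *: zeta) - 2 * u y) <= K * h ^+ 2) ->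
  qform X xi - qform Y zeta <= K.
Proof.
move=> ux uy h00 H; apply/ler_addgt0Pr => e e0.
have e20 : 0 < e / 2 by rewrite divr_gt0.
have [a a0 aP] := second_difference xi ux e20.
have [b b0 bP] := second_difference zeta uy e20.
pose m := Num.min h0 (Num.min a b).
have m0 : 0 < m by rewrite !lt_min h00 a0 b0.
pose h := m / 2.
have hm : 0 < h < m by rewrite /h divr_gt0//= ltr_pdivrMr// ltr_pMr// ltr1n.
have /andP[hp hlt] := hm.
have {H}H := H h; move: (hlt); rewrite !lt_min => /and3P[h1 h2 h3].
move: (H); rewrite hp h1 => /(_ isT) H'.
have := aP h; rewrite hp h2 => /(_ isT); rewrite ler_norml => /andP[A _].
have := bP h; rewrite hp h3 => /(_ isT); rewrite ler_norml => /andP[_ B].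
have h20 : 0 < h ^+ 2 by rewrite exprn_gt0.
rewrite -(ler_pM2r h20).
by move: A B H'; rewrite mulrBl mulrDl; lra.
Qed.

Lemma visc_sol_hessian (R : realType) n (G : symM R n -> R) x0 r u x :
  visc_sol G (eball x0 r) u -> C2 (eball x0 r) u -> eball x0 r x ->
  G (sympart (hessian u x)) = 0.
Proof.
move=> [_ Su su] u2 xr; apply/eqP; rewrite eq_le; apply/andP; split.
- apply: (su x (eball x0 r)) => //; first by split=> //; exact: open_eball.
  by split=> //; apply: filterE.
- apply: (Su x (eball x0 r)) => //; first by split=> //; exact: open_eball.
  by split=> //; apply: filterE.
Qed.

(** The profile of the doubling argument is [L * s - M * s ^ 2], with [M] this
    constant: [8 * M * lam] has to exceed [n ^ 2 * (64 * n * Lam)], the upper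
    bound that ellipticity puts on [n ^ 2 * lam * \tr N] at an interior maximum. *)
Definition concavity (R : realType) n (lam Lam : R) : R :=
  8 * (n * n * n)%:R * Lam / lam + 1.

(** Large enough for the profile to be nonnegative on [[0, 1/8]] and at least
    [2], a bound for the oscillation, at [1/8]. *)
Definition lipschitz_const (R : realType) n (lam Lam : R) : R :=
  16 + concavity n lam Lam.

Section lipschitz.
Context (R : realType) (n : nat) (lam Lam : R).
Hypothesis lam0 : 0 < lam.
Hypothesis lamLam : lam <= Lam.

Let M := concavity n lam Lam.
Let L := lipschitz_const n lam Lam.
Let omega (s : R) := L * s - M * s ^+ 2.

Let M0 : 0 < M.
Proof.
rewrite /M /concavity ltr_wpDl// divr_ge0 ?(ltW lam0)// mulr_ge0 ?mulr_ge0//.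
exact: le_trans (ltW lam0) lamLam.
Qed.

Let omega_ge0 s : 0 <= s -> s <= 8^-1 -> 0 <= omega s.
Proof.
move=> s0 s8; have -> : omega s = s * (16 + M * (1 - s)).
  by rewrite /omega /L /lipschitz_const -/M; ring.
rewrite mulr_ge0// addr_ge0// mulr_ge0 ?(ltW M0)// subr_ge0.
by apply: le_trans s8 _; lra.
Qed.

Let omega_end : 2 <= omega 8^-1.
Proof.
have := M0; rewrite /omega /L /lipschitz_const -/M.
have -> : (16 + M) * 8^-1 - M * 8^-1 ^+ 2 = 2 + M * (7 / 64) by field.
by move=> M0'; rewrite lerDl mulr_ge0// ltW.
Qed.

Context (G : symM R n -> R) (u : 'rV[R]_n -> R).
Context (g : 'rV[R]_n -> 'rV[R]_n) (H : 'rV[R]_n -> 'M[R]_n).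
Hypothesis GE : unif_elliptic lam Lam G.
Hypothesis cu : forall x, eball 0 1 x -> {for x, continuous u}.
Hypothesis uH : forall x, eball 0 1 x -> expansion u x (g x) (H x).
Hypothesis uG : forall x, eball 0 1 x -> G (sympart (H x)) = 0.
Hypothesis u1 : forall x, eball 0 1 x -> `|u x| <= 1.

(** The matrix inequalities at an interior maximum of the doubled function
    contradict ellipticity: the difference of the two Hessians is bounded
    above, but very negative in the direction joining the two points. *)
Lemma no_interior_max (x y e : 'rV[R]_n) :
  eball 0 1 x -> eball 0 1 y -> l2norm e = 1 ->
  (forall xi, qform (H x) xi - qform (H y) xi
     <= 64 * l2norm xi ^+ 2) ->
  qform (H x) e - qform (H y) e <= 64 - 8 * M -> False.
Proof.
move=> xB yB e1 H1 H2.
pose D : symM R n := sympart (H x) - sympart (H y).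
have qD v : qform D v = qform (H x) v - qform (H y) v.
  by rewrite /D symMD symMN bformBM !qform_sympart.
have P : psd (64 *: idS R n - D).
  by apply: psd_sub_idS => v; rewrite qD; exact: H1.
have k64 : (0 : R) <= 64 by rewrite ler0n.
have := elliptic_gap (sympart (H y)) GE k64 P.
have -> : sympart (H y) + D = sympart (H x) by rewrite /D addrC subrK.
rewrite !uG// !add0r => T.
have e1' : l2norm e <= 1 by rewrite e1.
have := psd_qform_le_tr P e1'.
rewrite [X in qform X _]symMD symMN bformBM qD idSZE qform_scalar e1 expr1n mulr1.
move: T; set t := \tr _ => T T2.
have T3 : 8 * M <= (n * n)%:R * t by lra.
have T4 : lam * (8 * M) <= (n * n)%:R * (Lam * (64 * n%:R)).
  apply: (@le_trans _ _ (lam * ((n * n)%:R * t))); first by rewrite ler_pM2l.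
  by rewrite mulrCA ler_wpM2l.
have E : lam * (8 * M)
    = (n * n)%:R * (Lam * (64 * n%:R)) + 8 * lam.
  by rewrite /M /concavity !natrM; field; rewrite gt_eqF.
by move: T4; rewrite E; have := lam0; lra.
Qed.

(** The doubled function [Psi] lives on pairs [(x, z)] standing for the points
    [x] and [x + z]. Moving both points in parallel bounds the difference of the
    Hessians from above; moving them apart along the line joining them brings in
    the concavity of the profile. *)
Lemma lipschitz_close (x0 z : 'rV[R]_n) : eball 0 2^-1 x0 -> l2norm z <= 8^-1 ->
  u x0 - u (x0 + z) <= omega (l2norm z).
Proof.
move=> x0B z8.
(* The penalty is worth 32 / 16 = 2 when x is at distance 1/4 from x0. *)
pose Psi (p : 'rV[R]_n * 'rV[R]_n) :=
  u p.1 - u (p.1 + p.2) - omega (l2norm (p.2 - 0)) - 32 * l2norm (p.1 - x0) ^+ 2.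
pose K := ceball x0 4^-1 `*` ceball (0 : 'rV[R]_n) 8^-1.
have KB1 p : K p -> eball 0 1 p.1.
  move=> [/= px _]; rewrite /eball/=.
  apply: le_lt_trans (l2normB_triangle x0 _ _) _.
  move: x0B px; rewrite /eball/ceball/= => a b; lra.
have KB2 p : K p -> eball 0 1 (p.1 + p.2).
  move=> [/= px]; rewrite /eball/ceball/= !subr0 => pz.
  apply: le_lt_trans (l2normD _ _) _.
  have := l2normD (p.1 - x0) x0; rewrite subrK.
  move: x0B px; rewrite /eball/ceball/= subr0 => a b c; lra.
have K0 : K !=set0.
  exists (x0, 0); split; rewrite /ceball/= ?subrr ?l2norm0 ?invr_ge0//.
have cK : compact K by apply: compact_setX; exact: compact_ceball.
have cPsi : {within K, continuous Psi}.
  apply: continuous_in_subspaceT => p; rewrite inE => Kp.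
  have c1 : {for p, continuous (fun p : 'rV[R]_n * 'rV[R]_n => p.1)}.
    exact: cvg_fst.
  have c2 : {for p, continuous (fun p : 'rV[R]_n * 'rV[R]_n => p.2)}.
    exact: cvg_snd.
  have c3 : {for p, continuous (fun p : 'rV[R]_n * 'rV[R]_n => p.1 + p.2)}.
    exact: (@continuousD _ _ _ fst snd).
  have d1 : {for p, continuous (fun p : 'rV[R]_n * 'rV[R]_n => u p.1)}.
    apply: (@continuous_comp _ _ _ fst u) => //.
    exact: cu (KB1 p Kp).
  have d2 : {for p, continuous (fun p : 'rV[R]_n * 'rV[R]_n => u (p.1 + p.2))}.
    apply: (@continuous_comp _ _ _ (fun p : 'rV[R]_n * 'rV[R]_n => p.1 + p.2) u) => //.
    exact: cu (KB2 p Kp).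
  have d3 : {for p, continuous
      (fun p : 'rV[R]_n * 'rV[R]_n => l2norm (p.2 - 0))}.
    apply: (@continuous_comp _ _ _ snd (fun z : 'rV[R]_n => l2norm (z - 0))) => //.
    exact: continuous_l2norm.
  have d4 : {for p, continuous
      (fun p : 'rV[R]_n * 'rV[R]_n => l2norm (p.1 - x0))}.
    apply: (@continuous_comp _ _ _ fst (fun z : 'rV[R]_n => l2norm (z - x0))) => //.
    exact: continuous_l2norm.
  apply: cvgB; [apply: cvgB; [exact: cvgB|]|].
  - apply: cvgB; apply: cvgM; try exact: cvg_cst; first exact: d3.
    exact: (@cvgM _ _ _ _ _ _ _ _ d3 d3).
  - apply: cvgM; first exact: cvg_cst.
    exact: (@cvgM _ _ _ _ _ _ _ _ d4 d4).
have [[x w] /[!inE] Kxw Kmax] := compact_EVT_max K0 cK cPsi.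
have {}Kmax q : K q -> Psi q <= Psi (x, w) by move=> Kq; apply: Kmax; rewrite inE.
suff neg : Psi (x, w) <= 0.
  have Kz : K (x0, z).
    by split; rewrite /ceball/= ?subr0// subrr l2norm0 invr_ge0.
  rewrite -subr_le0; apply: le_trans neg; apply: le_trans (Kmax _ Kz).
  by rewrite /Psi/= subrr l2norm0 expr0n/= mulr0 !subr0.
rewrite leNgt; apply/negP => pos.
have xB := KB1 _ Kxw; have yB := KB2 _ Kxw; rewrite /= in xB yB.
have [Kx Kw] := Kxw; rewrite /ceball/= subr0 in Kx Kw.
have ux := u1 xB; have uy := u1 yB; rewrite !ler_norml in ux uy.
have /andP[ux1 ux2] := ux; have /andP[uy1 uy2] := uy.
have om0 : 0 <= omega (l2norm w) by apply: omega_ge0 => //; exact: l2norm_ge0.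
have sq0 : 0 <= l2norm (x - x0) ^+ 2 by rewrite exprn_ge0// l2norm_ge0.
rewrite /Psi/= !subr0 in pos.
have w0 : 0 < l2norm w.
  apply: l2norm_gt0 => w0; move: pos; rewrite w0 addr0 subrr l2norm0.
  have -> : omega 0 = 0 by rewrite /omega mulr0 expr0n/= mulr0 subr0.
  by rewrite subr0 sub0r; lra.
have x4 : l2norm (x - x0) < 4^-1.
  rewrite lt_neqAle Kx andbT; apply/eqP => E; move: pos; rewrite E.
  have -> : 32 * 4^-1 ^+ 2 = 2 :> R by field.
  lra.
have w8 : l2norm w < 8^-1.
  rewrite lt_neqAle Kw andbT; apply/eqP => E; move: pos; rewrite E.
  have := omega_end; lra.
pose s := l2norm w.
pose e := - (s^-1 *: w).
have e1 : l2norm e = 1.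
  by rewrite l2normN l2normZ gtr0_norm ?invr_gt0// mulVf// gt_eqF.
apply: (@no_interior_max x (x + w) e) => //.
- move=> xi.
  have q0 : 0 < l2norm xi + 1 by rewrite ltr_wpDl// l2norm_ge0.
  pose h0 := (4^-1 - l2norm (x - x0)) / (l2norm xi + 1).
  have h00 : 0 < h0 by rewrite divr_gt0// subr_gt0.
  apply: (@max_second_order _ _ u x (x + w) _ _ _ _ xi xi _ h0
    (uH xB) (uH yB) h00) => h /andP[hp].
  rewrite ltr_pdivlMr// => hh.
  have hxi : h * l2norm xi <= 4^-1 - l2norm (x - x0).
    by apply: le_trans (ltW hh); rewrite ler_pM2l// lerDl.
  have K1 : K (x + h *: xi, w).
    split; rewrite /ceball/= ?subr0//; rewrite addrAC.
    by apply: le_trans (l2normD _ _) _; rewrite l2normZ gtr0_norm//; lra.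
  have K2 : K (x - h *: xi, w).
    split; rewrite /ceball/= ?subr0//; rewrite addrAC.
    apply: le_trans (l2normD _ _) _; rewrite l2normN l2normZ gtr0_norm//; lra.
  have := Kmax _ K1; have := Kmax _ K2; rewrite /Psi/=.
  rewrite (addrAC x (h *: xi) w) (addrAC x (- (h *: xi)) w).
  rewrite (addrAC x (h *: xi) (- x0)) (addrAC x (- (h *: xi)) (- x0)).
  have := l2norm_parallelogram (x - x0) (h *: xi).
  rewrite l2normZ exprMn real_normK ?num_real//.
  by move=> *; lra.
- have qe : qform (H (x + w)) (- e) = qform (H (x + w)) e.
    by rewrite -scaleN1r bformZl bformZr; ring.
  rewrite -qe; pose h0 := Num.min (s / 2) (Num.min ((8^-1 - s) / 2) (4^-1 - l2norm (x - x0))).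
  have h00 : 0 < h0.
    by rewrite !lt_min !divr_gt0//= subr_gt0 ?w8//= subr_gt0.
  apply: (@max_second_order _ _ u x (x + w) _ _ _ _ e (- e) _ h0
    (uH xB) (uH yB) h00) => h.
  rewrite !lt_min => /and4P[hp hs h8 h4].
  (* Here z = w - 2 k e is the position of y - k e relative to x + k e. *)
  have we k : w - (k * 2) *: e = (1 + k * 2 / s) *: w.
    by rewrite scalerN opprK scalerA scalerDl scale1r.
  have nw k : - s < k * 2 -> l2norm (w - (k * 2) *: e) = s + k * 2.
    move=> ks; rewrite we l2normZ ger0_norm -/s.
      by field; rewrite gt_eqF.
    have -> : 1 + k * 2 / s = (s + k * 2) / s by field; rewrite gt_eqF.
    by rewrite divr_ge0 ?l2norm_ge0//; lra.
  have nh1 : l2norm (w - (h * 2) *: e) = s + h * 2 by apply: nw; lra.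
  have nh2 : l2norm (w - (- h * 2) *: e) = s + - h * 2 by apply: nw; lra.
  have K1 : K (x + h *: e, w - (h * 2) *: e).
    split; rewrite /ceball/=; last by rewrite subr0 nh1; lra.
    rewrite addrAC; apply: le_trans (l2normD _ _) _.
    by rewrite l2normZ e1 mulr1 gtr0_norm//; lra.
  have K2 : K (x - h *: e, w - (- h * 2) *: e).
    split; rewrite /ceball/=; last by rewrite subr0 nh2; lra.
    rewrite addrAC; apply: le_trans (l2normD _ _) _.
    by rewrite l2normN l2normZ e1 mulr1 gtr0_norm//; lra.
  have := Kmax _ K1; have := Kmax _ K2; rewrite /Psi/= !subr0 nh1 nh2 -/s.
  have -> : x + h *: e + (w - (h * 2) *: e) = x + w + h *: - e.
    by apply/rowP => i; rewrite !mxE; ring.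
  have -> : x - h *: e + (w - (- h * 2) *: e) = x + w - h *: - e.
    by apply/rowP => i; rewrite !mxE; ring.
  rewrite (addrAC x (h *: e) (- x0)) (addrAC x (- (h *: e)) (- x0)).
  have := l2norm_parallelogram (x - x0) (h *: e).
  rewrite l2normZ exprMn real_normK ?num_real// e1 expr1n mulr1.
  have : omega (s + h * 2) + omega (s + - h * 2) - 2 * omega s = - (8 * M * h ^+ 2).
    by rewrite /omega; ring.
  have -> : (64 - 8 * M) * h ^+ 2 = 64 * h ^+ 2 - 8 * M * h ^+ 2 by ring.
  by move=> *; lra.
Qed.

Lemma interior_lipschitz (x y : 'rV[R]_n) :
  eball 0 2^-1 x -> eball 0 2^-1 y -> `|u x - u y| <= L * l2norm (x - y).
Proof.
have L16 : 16 <= L by rewrite /L /lipschitz_const lerDl ltW.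
have half : eball (0 : 'rV[R]_n) 2^-1 `<=` eball 0 1.
  by move=> z; rewrite /eball/= => zB; lra.
have one a b : eball 0 2^-1 a -> eball 0 2^-1 b -> u a - u b <= L * l2norm (a - b).
  move=> aB bB; have [ab|ab] := leP (l2norm (a - b)) 8^-1.
    have := @lipschitz_close a (b - a) aB; rewrite (l2normBC b).
    rewrite (_ : a + (b - a) = b); last by rewrite addrC subrK.
    move=> /(_ ab) Hl; apply: le_trans Hl _.
    by rewrite /omega gerBl mulr_ge0 ?(ltW M0)// exprn_ge0// l2norm_ge0.
  apply: (@le_trans _ _ (16 * l2norm (a - b))); last first.
    by rewrite ler_wpM2r// l2norm_ge0.
  have := u1 (half _ aB); have := u1 (half _ bB).
  by rewrite !ler_norml => /andP[? ?] /andP[? ?]; lra.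
move=> xB yB; rewrite ler_norml one// andbT lerNl opprB l2normBC.
exact: one.
Qed.

End lipschitz.

(** * Stability of viscosity solutions along ultrafilters *)

Lemma filter_ex2 (T : Type) (F : set_system T) (A B : set T) :
  ProperFilter F -> F A -> F B -> exists k, A k /\ B k.
Proof.
move=> FF FA FB; have : F (A `&` B) by exact: filterI.
by move=> /filter_ex[k [Ak Bk]]; exists k.
Qed.

Lemma ultra_fmap (T U : Type) (f : T -> U) (F : set_system T) :
  UltraFilter F -> UltraFilter (f @ F).
Proof.
move=> FU; apply: Build_UltraFilter => G GF sG.
rewrite eqEsubset; split=> A; last exact: sG.
move=> GA; have [//|FnA] := in_ultra_setVsetC (f @^-1` A) FU.
have GnA : G (~` A) by apply: sG.
by have [x [Ax nAx]] := filter_ex2 GF GA GnA.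
Qed.

Lemma ultra_compact_cvg (T : Type) (U : topologicalType) (F : set_system T)
    (K : set U) (f : T -> U) :
  UltraFilter F -> compact K -> (forall k, K (f k)) ->
  exists2 p, K p & f @ F --> p.
Proof.
move=> FU cK Kf; move: cK; rewrite compact_ultra => /(_ (f @ F)) cK.
have [|p [Kp fp]] := cK (ultra_fmap f FU); last by exists p.
by apply: (@filterS _ F _ setT _ (fun k _ => Kf k)); exact: filterT.
Qed.

(** A common Lipschitz constant upgrades pointwise convergence along an
    ultrafilter to uniform convergence: bad points would themselves converge. *)
Lemma ultra_equilipschitz_uniform (R : realType) n (T : Type)
    (F : set_system T) (x0 : 'rV[R]_n) (r L : R) (w : T -> 'rV[R]_n -> R)
    (u : 'rV[R]_n -> R) : UltraFilter F -> 0 < L ->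
  (forall k x y, eball x0 r x -> eball x0 r y ->
     `|w k x - w k y| <= L * l2norm (x - y)) ->
  (forall x, eball x0 r x -> w k x @[k --> F] --> u x) ->
  (forall x y, eball x0 r x -> eball x0 r y ->
     `|u x - u y| <= L * l2norm (x - y)) /\
  (forall eps, 0 < eps ->
     \forall k \near F, forall x, eball x0 r x -> `|w k x - u x| <= eps).
Proof.
move=> FU L0 wL wu.
have uL x y : eball x0 r x -> eball x0 r y -> `|u x - u y| <= L * l2norm (x - y).
  move=> xB yB; apply/ler_addgt0Pr => e e0.
  have e20 : 0 < e / 2 by rewrite divr_gt0.
  have /(@cvgrPdist_lt _ _ _ F _)/(_ _ e20) A := wu x xB.
  have /(@cvgrPdist_lt _ _ _ F _)/(_ _ e20) B := wu y yB.
  have [k [ak bk]] := @filter_ex2 _ F _ _ _ A B.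
  have := wL k x y xB yB.
  move: ak bk; rewrite !ltr_norml !ler_norml => /andP[? ?] /andP[? ?] /andP[? ?].
  by apply/andP; split; lra.
split=> // eps eps0.
pose Good := [set k | forall x, eball x0 r x -> `|w k x - u x| <= eps].
have [//|bad] := in_ultra_setVsetC Good FU.
have [z zP] : exists z : T -> 'rV[R]_n, forall k, ~ Good k ->
    eball x0 r (z k) /\ eps < `|w k (z k) - u (z k)|.
  suff : forall k, exists z, ~ Good k ->
      eball x0 r z /\ eps < `|w k z - u z|.
    by move=> /choice[z zP]; exists z.
  move=> k; have [Gk|nGk] := pselect (Good k); first by exists x0.
  have /existsNP[z /not_implyP[zB /negP zw]] := nGk.
  by exists z => _; rewrite ltNge.
pose z' k := if pselect (Good k) is left _ then x0 else z k.
have [k0 bk0] := filter_ex bad.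
have z'K k : ceball x0 r (z' k).
  rewrite /z'; case: pselect => [Gk|nGk].
    have [+ _] := zP k0 bk0; rewrite /eball/ceball/= subrr l2norm0.
    by move=> /ltW; apply: le_trans; exact: l2norm_ge0.
  by have [+ _] := zP k nGk; rewrite /eball/ceball/=; exact: ltW.
have [p _ z'p] := ultra_compact_cvg FU (@compact_ceball R n x0 r) z'K.
pose d := eps / (8 * L).
have d0 : 0 < d by rewrite divr_gt0// mulr_gt0.
have np : nbhs p (eball p d) by apply: nbhs_eball; exact: eball_center.
have A : F (z' @^-1` eball p d) by exact: z'p np.
have [k1 [bk1 ak1]] := filter_ex2 _ bad A.
have z'E k : ~ Good k -> z' k = z k by rewrite /z'; case: pselect.
have z1B : eball x0 r (z k1) by have [] := zP k1 bk1.
have z1p : l2norm (z k1 - p) < d by move: ak1; rewrite /= z'E.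
have e40 : 0 < eps / 4 by rewrite divr_gt0.
have /(@cvgrPdist_lt _ _ _ F _)/(_ _ e40) B := wu _ z1B.
have bA : F (~` Good `&` z' @^-1` eball p d) by exact: filterI.
have [k [[bk ak] Bk]] := @filter_ex2 _ F _ _ _ bA B.
have [zkB zke] := zP k bk.
have zkp : l2norm (z k - p) < d by move: ak; rewrite /= z'E.
have dist : L * l2norm (z k - z k1) <= eps / 4.
  have -> : eps / 4 = L * (d + d) by rewrite /d; field; rewrite gt_eqF.
  rewrite ler_pM2l//; apply: (le_trans (l2normB_triangle p _ _)).
  by rewrite (l2normBC p) lerD// ltW.
have := wL k _ _ zkB z1B; have := uL _ _ zkB z1B.
have T3 (a b c d' : R) : `|a - d'| <= `|a - b| + `|b - c| + `|c - d'|.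
  have -> : a - d' = (a - b) + (b - c) + (c - d') by ring.
  by apply: le_trans (ler_normD _ _) _; rewrite lerD2r ler_normD.
have := T3 (w k (z k)) (w k (z k1)) (u (z k1)) (u (z k)).
rewrite (distrC (u (z k1)) (u (z k))) => t3 t2 t1.
have {}Bk : `|w k (z k1) - u (z k1)| < eps / 4 by rewrite distrC.
exfalso; lra.
Qed.

Section stability.
Context (R : realType) (n : nat) (lam Lam : R) (T : Type) (F : set_system T).
Context {FF : ProperFilter F}.
Context (Gk : T -> symM R n -> R) (G : symM R n -> R).
Context (w : T -> 'rV[R]_n -> R) (u : 'rV[R]_n -> R) (Omega : set 'rV[R]_n).
Hypothesis lam0 : 0 < lam.
Hypothesis Lam0 : 0 < Lam.
Hypothesis GkE : forall k, unif_elliptic lam Lam (Gk k).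
Hypothesis GkG : forall M, Gk k M @[k --> F] --> G M.
Hypothesis Oo : open Omega.
Hypothesis cw : forall k x, Omega x -> {for x, continuous (w k)}.
Hypothesis wG : forall k, subsol (Gk k) Omega (w k).
Hypothesis wu : forall eps, 0 < eps ->
  \forall k \near F, forall x, Omega x -> `|w k x - u x| <= eps.

Lemma add_paraboloid (V : set 'rV[R]_n) (phi : 'rV[R]_n -> R) x c eps :
  open V -> C2 V phi ->
  exists psi, [/\ forall z, psi z = phi z + (c + eps * l2norm (z - x) ^+ 2),
    C2 V psi & forall y, V y -> hessian psi y = hessian phi y + (2 * eps)%:M].
Proof.
move=> Vo phi2.
have AT : ((2 * eps)%:M : 'M[R]_n)^T = (2 * eps)%:M by rewrite tr_scalar_mx.
have [a [b E]] := quad_translate c 0 (- x) AT.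
have VE : V = (fun z : 'rV[R]_n => 1 *: (z - 0)) @^-1` V.
  by apply/funext => y /=; rewrite scale1r subr0.
exists (pullback 1 1 0 phi a b (2 * eps)%:M); split.
- move=> z; rewrite /pullback scale1r subr0 mul1r -E /quad.
  rewrite qform_scalar big1 => [|i _]; last by rewrite mxE mul0r.
  by field.
- by rewrite [X in C2 X]VE; apply: C2_pullback.
- move=> y Vy; have Vy' : ((fun z : 'rV[R]_n => 1 *: (z - 0)) @^-1` V) y.
    by rewrite -VE.
  rewrite (hessian_pullback 1 a b AT Vo phi2 Vy').
  by rewrite subr0 expr1n mulr1 !scale1r.
Qed.

(** Test functions are made strict by a small paraboloid, so that they touch
    the approximating solutions at nearby points. *)
Lemma subsol_stable : subsol G Omega u.
Proof.
move=> x V phi Ox xV phi2 [phix phiu].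
pose M0 := sympart (hessian phi x).
suff key eps : 0 < eps -> 0 <= G M0 + Lam * ((3 * eps) * n%:R) + eps.
  apply/ler_addgt0Pr => e e0.
  pose K := Lam * (3 * n%:R) + 1.
  have K0 : 0 < K by rewrite ltr_wpDl// mulr_ge0 ?(ltW Lam0)// mulr_ge0.
  have e'0 : 0 < e / K by rewrite divr_gt0.
  have := key _ e'0.
  have E : e / K * (Lam * (3 * n%:R) + 1) = e by rewrite -/K divfK// gt_eqF.
  have -> : G M0 + Lam * (3 * (e / K) * n%:R) + e / K
      = G M0 + e / K * (Lam * (3 * n%:R) + 1) by ring.
  by rewrite E.
move=> eps0.
have [t t0 [tV tP]] := C2_hessian_near xV phi2 eps0.
have [t1 t10 t1P] := (nbhs_eballP x _).1 phiu.
have /Oo/nbhs_eballP[t2 t20 t2P] : Omega x by [].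
pose m := Num.min t (Num.min t1 t2).
have m0 : 0 < m by rewrite !lt_min t0 t10 t20.
pose r := m / 2.
have r0 : 0 < r by rewrite divr_gt0.
have rm : r < m by rewrite /r ltr_pdivrMr// ltr_pMr// ltr1n.
have cB y : ceball x r y -> [/\ eball x t y, eball x t1 y & eball x t2 y].
  rewrite /ceball/eball/= => yr.
  have : l2norm (y - x) < m by apply: le_lt_trans yr rm.
  by rewrite !lt_min => /and3P[].
pose d := eps * r ^+ 2 / 4.
have d0 : 0 < d by rewrite divr_gt0// mulr_gt0// exprn_gt0.
have /(@cvgrPdist_lt _ _ _ F _)/(_ _ eps0) A := @GkG M0.
have [k [Ak wk]] := @filter_ex2 _ F _ _ _ A (wu d0).
have xr : ceball x r x by rewrite /ceball/= subrr l2norm0 ltW.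
pose f z := w k z - phi z - eps * l2norm (z - x) ^+ 2.
have cf : {within ceball x r, continuous f}.
  apply: continuous_in_subspaceT => y; rewrite inE => yr.
  have [y0 y1 y2] := cB y yr.
  have c1 := @cw k y (t2P _ y2).
  have [c2 _ _] := phi2 y (tV _ y0).
  have c3 := @continuous_l2norm R n x y.
  apply: continuousBf; first exact: continuousBf.
  apply: continuousMf; first exact: cst_continuous.
  exact: continuousMf.
have [|y /[!inE] yr ymax] := @compact_EVT_max _ R f (ceball x r) _
    (@compact_ceball _ _ _ _) cf; first by exists x.
have {}ymax z : ceball x r z -> f z <= f y.
  by move=> zr; apply: ymax; rewrite inE.
have [y0 y1 y2] := cB y yr.
have yx : l2norm (y - x) < r.
  rewrite lt_neqAle; move: (yr); rewrite /ceball/= => ->; rewrite andbT.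
  apply/eqP => E; have := ymax x xr; rewrite /f E subrr l2norm0 expr0n/= mulr0 subr0.
  have := wk x Ox; have := wk y (t2P _ y2); have := t1P y y1.
  rewrite phix /= !ler_norml /d => H1 /andP[H2 H3] /andP[H4 H5].
  have : 0 < eps * r ^+ 2 by rewrite mulr_gt0// exprn_gt0.
  move=> H6 H7; lra.
pose c := w k y - phi y - eps * l2norm (y - x) ^+ 2.
have [psi [psiE psi2 Hpsi]] := add_paraboloid x c eps xV.1 phi2.
have Vy : V y by exact: tV.
have : 0 <= Gk k (sympart (hessian psi y)).
  apply: (@wG k y V psi (t2P _ y2) _ psi2); first by split=> //; exact: xV.1.
  split; first by rewrite psiE /c; ring.
  apply/nbhs_eballP; exists (r - l2norm (y - x)); first by rewrite subr_gt0.
  move=> z; rewrite /eball/= => zy.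
  have := ymax z; rewrite psiE /f /c => Hz.
  have : ceball x r z.
    rewrite /ceball/=; apply: (le_trans (l2normB_triangle y _ _)); lra.
  by move=> /Hz; lra.
rewrite Hpsi// => Hk; apply: le_trans Hk _.
pose D := sympart (hessian phi y + (2 * eps)%:M) - M0.
have -> : sympart (hessian phi y + (2 * eps)%:M) = M0 + D.
  by rewrite /D [RHS]addrC subrK.
have k0 : 0 <= 3 * eps by rewrite mulr_ge0// ltW.
have qD v : qform D v <= 3 * eps * l2norm v ^+ 2.
  rewrite /D symMD symMN bformBM !qform_sympart bformDM qform_scalar.
  have -> : 3 * eps * l2norm v ^+ 2 = eps * l2norm v ^+ 2 + 2 * eps * l2norm v ^+ 2.
    by ring.
  rewrite addrAC -bformBM lerD2r; apply: le_trans (ler_norm _) _.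
  apply: le_trans (qform_le_l2norm _ _) _.
  by rewrite ler_wpM2r ?exprn_ge0 ?l2norm_ge0//; exact: tP.
have H := elliptic_le lam0 M0 (@GkE k) k0 qD.
apply: le_trans H _.
move: Ak; rewrite /= ltr_norml => /andP[a1 a2]; lra.
Qed.

End stability.

(** * Approximation by quadratic polynomials on some scale *)

Lemma hoelder_bound (R : realType) n (beta : R) (g : 'rV[R]_n -> 'M[R]_n) E :
  (hoelder_seminorm beta g E < +oo)%E ->
  exists2 C, 0 <= C & forall x y, E x -> E y ->
    l2norm (g x - g y) <= C * l2norm (x - y) `^ beta.
Proof.
move=> fin.
have [C C0 CP] : exists2 C : R, 0 <= C & (hoelder_seminorm beta g E <= C%:E)%E.
  move: fin; case: (hoelder_seminorm beta g E) => [c _|//|_].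
    by exists (Num.max c 0); rewrite ?lee_fin le_max lexx ?orbT.
  by exists 0 => //; rewrite leNye.
exists C => // x y Ex Ey; have [->|/eqP xy] := eqVneq x y.
  by rewrite subrr l2norm0 mulr_ge0// powR_ge0.
have d0 : 0 < l2norm (x - y) `^ beta.
  by rewrite powR_gt0// l2norm_gt0// => /subr0_eq.
rewrite -ler_pdivrMr// -lee_fin; apply: le_trans CP.
by apply: ereal_sup_ubound; exists x, y.
Qed.

Lemma subsol_sub (R : realType) n (G : symM R n -> R) (U V : set 'rV[R]_n) u :
  V `<=` U -> subsol G U u -> subsol G V u.
Proof. by move=> VU su x W phi /VU; exact: su. Qed.

Lemma lipschitz_continuous (R : realType) n (x0 : 'rV[R]_n) r L
    (u : 'rV[R]_n -> R) :
  0 < L -> (forall x y, eball x0 r x -> eball x0 r y ->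
     `|u x - u y| <= L * l2norm (x - y)) ->
  forall x, eball x0 r x -> {for x, continuous u}.
Proof.
move=> L0 uL x xB; apply/continuous_eballP => e e0.
have /nbhs_eball /nbhs_eballP[t t0 tP] := xB.
exists (Num.min t (e / L)); first by rewrite lt_min t0 divr_gt0.
move=> y; rewrite /eball/= lt_min => /andP[yt ye].
apply: le_lt_trans (uL x y xB (tP _ yt)) _.
by rewrite mulrC -ltr_pdivlMr// l2normBC.
Qed.

(** The power that is lost, [gamma - beta], pays for the constant. *)
Lemma absorb_constant (R : realType) (C beta gamma : R) : 0 <= C ->
  beta < gamma -> exists2 rho, 0 < rho <= 4^-1 &
    C * rho `^ (2 + gamma) <= 2^-1 * rho `^ (2 + beta).
Proof.
move=> C0 bg; have d0 : 0 < gamma - beta by rewrite subr_gt0.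
have C1 : 0 < 2 * (C + 1) by rewrite mulr_gt0// ltr_wpDl.
pose q := (2 * (C + 1))^-1 `^ (gamma - beta)^-1.
have q0 : 0 < q by rewrite powR_gt0// invr_gt0.
pose rho := Num.min 4^-1 q.
have r0 : 0 < rho by rewrite lt_min q0 andbT invr_gt0.
exists rho; first by rewrite r0 ge_min lexx.
have -> : 2 + gamma = (2 + beta) + (gamma - beta) by ring.
rewrite powRD; last by apply/implyP => _; rewrite gt_eqF.
rewrite mulrCA [2^-1 * _]mulrC ler_pM2l ?powR_gt0//.
have : rho `^ (gamma - beta) <= (2 * (C + 1))^-1.
  have <- : q `^ (gamma - beta) = (2 * (C + 1))^-1.
    by rewrite /q -powRrM mulVf ?gt_eqF// powRr1// invr_ge0 ltW.
  have rq : rho <= q by rewrite ge_min lexx orbT.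
  by apply: ge0_ler_powR => //; rewrite ?nnegrE ltW.
move=> H; apply: le_trans (ler_wpM2l C0 H) _.
rewrite ler_pdivrMr// mulrA mulVf ?mul1r ?lerDl//.
Qed.

Section compactness.
Context (R : realType) (n : nat) (lam Lam gamma : R) (F : set (symM R n -> R)).
Hypothesis n0 : (0 < n)%N.
Hypothesis lam0 : 0 < lam.
Hypothesis lamLam : lam <= Lam.
Hypothesis FE : F `<=` elliptic lam Lam.
Hypothesis Fcompact : compact (F : set {family compact, symM R n -> R}).
Hypothesis Fregular : forall G x0 (r : R) u, F G -> 0 < r ->
  visc_sol G (eball x0 r) u -> C2hoelder_loc gamma (eball x0 r) u.
Context (beta : R).
Hypothesis beta0 : 0 < beta.
Hypothesis beta_gamma : beta < gamma.

Definition normalized_solution (G : symM R n -> R) (u : 'rV[R]_n -> R) : Prop :=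
  [/\ F G, visc_sol G (eball 0 1) u & forall x, eball 0 1 x -> `|u x| <= 1].

Definition approximable (G : symM R n -> R) (u : 'rV[R]_n -> R) (rho : R) :=
  exists a b (A : symM R n), G A = 0 /\
    forall x, eball 0 rho x -> `|u x - quad a b A x| <= rho `^ (2 + beta).

Let L := lipschitz_const n lam Lam.

Let Lam0 : 0 < Lam. Proof. exact: lt_le_trans lamLam. Qed.

Let L0 : 0 < L.
Proof.
rewrite /L /lipschitz_const /concavity ltr_wpDr// addr_ge0//.
by rewrite divr_ge0 ?ltW// mulr_gt0// mulr_gt0// ltr0n !muln_gt0 n0.
Qed.

Lemma F_unif_elliptic G : F G -> unif_elliptic lam Lam G.
Proof. by move=> /FE[_ _ H] M N; exact: H. Qed.

Lemma normalized_C2 G u : normalized_solution G u -> C2 (eball 0 1) u.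
Proof. by move=> [FG uG _]; have [] := Fregular FG ltr01 uG. Qed.

Lemma normalized_lipschitz G u : normalized_solution G u ->
  forall x y, eball 0 2^-1 x -> eball 0 2^-1 y ->
    `|u x - u y| <= L * l2norm (x - y).
Proof.
move=> uN; have u2 := normalized_C2 uN; have [FG uG u1] := uN => x y xB yB.
apply: (interior_lipschitz lam0 lamLam (F_unif_elliptic FG) _ _ _ u1 xB yB).
- by move=> z zB; have [cu _ _] := uG; exact: cu.
- move=> z zB; apply: (C2_expansion _ u2).
  by split=> //; exact: open_eball.
- by move=> z zB; exact: visc_sol_hessian uG u2 zB.
Qed.

(** The uniform Lipschitz estimate is what makes a pointwise limit of solutions
    along an ultrafilter a locally uniform one, hence a solution. *)
Lemma limit_solution (U : set_system nat) (Gk : nat -> symM R n -> R)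
    (G : symM R n -> R) (w : nat -> 'rV[R]_n -> R) (u : 'rV[R]_n -> R) :
  UltraFilter U -> (forall k, normalized_solution (Gk k) (w k)) ->
  (forall M, Gk k M @[k --> U] --> G M) ->
  (forall x, eball 0 2^-1 x -> w k x @[k --> U] --> u x) ->
  visc_sol G (eball 0 2^-1) u /\
  forall eps, 0 < eps -> \forall k \near U,
    forall x, eball 0 2^-1 x -> `|w k x - u x| <= eps.
Proof.
move=> UU wN GkG wu.
have wL k := normalized_lipschitz (wN k).
have [uL unif] := ultra_equilipschitz_uniform UU L0 wL wu.
have half : eball (0 : 'rV[R]_n) 2^-1 `<=` eball 0 1.
  by move=> z; rewrite /eball/= => zB; lra.
have GE k : unif_elliptic lam Lam (Gk k).
  by have [FG _ _] := wN k; exact: F_unif_elliptic.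
have cw k x : eball 0 2^-1 x -> {for x, continuous (w k)}.
  exact: lipschitz_continuous L0 (wL k) x.
split=> //; apply/visc_solE; split.
- exact: lipschitz_continuous L0 uL.
- apply: (subsol_stable lam0 Lam0 GE GkG (@open_eball R n 0 2^-1) cw _ unif) => k.
  by have [_ /visc_solE[_ su _] _] := wN k; exact: subsol_sub half su.
- apply: (@subsol_stable R n lam Lam nat U _ (fun k => dual (Gk k)) (dual G)
    (fun k x => - w k x) _ _ lam0 Lam0 _ _ (@open_eball R n 0 2^-1)).
  + by move=> k; exact: unif_elliptic_dual.
  + by move=> M; apply: cvgN; exact: GkG.
  + by move=> k x xB; apply: continuousN; exact: cw.
  + by move=> k; have [_ /visc_solE[_ _ su] _] := wN k; exact: subsol_sub half su.
  + move=> eps e0; apply: filterS (unif eps e0) => k H x xB.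
    by rewrite -opprD normrN; exact: H.
Qed.

(** Otherwise some normalized solutions [w k] are approximable at no scale
    between [1 / (k + 2)] and [1 / 2]. A limit of them solves a limit equation of
    the family, so it has its own [C^{2,gamma}] expansion at the origin and is
    well approximated, with room to spare, at some scale; this is inherited by
    nearby [w k] once the Hessian of the polynomial is corrected by a small
    multiple of the identity. *)
Lemma exists_scale : exists2 delta, 0 < delta <= 2^-1 &
  forall G u, normalized_solution G u ->
    exists2 rho, delta <= rho <= 2^-1 & approximable G u rho.
Proof.
apply: contrapT => noscale.
have bad k : exists Gu : (symM R n -> R) * ('rV[R]_n -> R),
    normalized_solution Gu.1 Gu.2 /\
    forall rho, k.+2%:R^-1 <= rho <= 2^-1 -> ~ approximable Gu.1 Gu.2 rho.
  apply: contrapT => H; apply: noscale; exists k.+2%:R^-1.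
    by rewrite invr_gt0 ltr0n/= lef_pV2 ?posrE ?ltr0n// ler_nat.
  move=> G u uN; apply: contrapT => H2; apply: H; exists (G, u); split=> //=.
  by move=> rho rhok A; apply: H2; exists rho.
have [Gu GuP] := choice bad.
pose Gk k := (Gu k).1; pose w k := (Gu k).2.
have wN k : normalized_solution (Gk k) (w k) by have [] := GuP k.
have [U [UU ooU]] := ultraFilterLemma (@eventually_filter).
have FGk k : F (Gk k) by have [] := wN k.
have [G FG GkG'] := @ultra_compact_cvg _ _ U _
  (Gk : nat -> {family compact, symM R n -> R}) UU Fcompact FGk.
have GkG M : Gk k M @[k --> U] --> G M.
  have FGk' : Filter (Gk @ U) by exact: fmap_filter.
  have P := @pointwise_cvg_compact_family _ _ (Gk @ U) _ FGk' GkG'.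
  exact: (@pointwise_cvgP _ _ (Gk @ U) _ FGk').1 P M.
have [u wu] : exists u : 'rV[R]_n -> R, forall x, eball 0 2^-1 x ->
    w k x @[k --> U] --> u x.
  suff H : forall x : 'rV[R]_n, exists l : R,
      eball 0 2^-1 x -> w k x @[k --> U] --> l.
    by have [u uP] := choice H; exists u.
  move=> x; have [xB|nxB] := pselect (eball 0 2^-1 x); last by exists 0.
  have wI k : `[(-1), 1]%classic (w k x).
    have [_ _ w1] := wN k; have := w1 x; rewrite /= in_itv/= ler_norml; apply.
    by move: xB; rewrite /eball/= => ?; lra.
  have [l _ lP] := ultra_compact_cvg UU (@segment_compact R (-1) 1) wI.
  by exists l.
have [uG unif] := limit_solution UU wN GkG wu.
have half0 : (0 : R) < 2^-1 by rewrite invr_gt0.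
have [u2 uH] := Fregular FG half0 uG.
have KB : ceball (0 : 'rV[R]_n) 4^-1 `<=` eball 0 2^-1.
  by move=> z; rewrite /ceball/eball/= => ?; lra.
have [C C0 CP] := hoelder_bound (uH _ (@compact_ceball R n 0 4^-1) KB).
have [rho /andP[r0 r4] rhoP] := absorb_constant C0 beta_gamma.
have r2 : rho <= 2^-1 by apply: le_trans r4 _; lra.
have z0 : eball (0 : 'rV[R]_n) 2^-1 0 by exact: eball_center.
pose A0 := sympart (hessian u 0).
have GA0 : G A0 = 0 by exact: visc_sol_hessian uG u2 z0.
pose th := 2 + beta.
have rt0 : 0 < rho `^ th by rewrite powR_gt0.
have T x : eball 0 rho x ->
    `|u x - quad (u 0) (grad u 0) A0 x| <= 2^-1 * rho `^ th.
  rewrite /eball/= subr0 => xr.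
  have inK (y : 'rV[R]_n) : eball 0 rho y -> ceball 0 4^-1 y.
    by rewrite /eball/ceball/= => /ltW yr; exact: le_trans yr r4.
  have u2r : C2 (eball 0 rho) u by apply: C2_sub u2 => y /inK /KB.
  have Hr y : eball 0 rho y -> l2norm (hessian u y - hessian u 0) <= C * rho `^ gamma.
    move=> yr; have K0 : ceball (0 : 'rV[R]_n) 4^-1 0.
      by rewrite /ceball/= subrr l2norm0 invr_ge0.
    apply: le_trans (CP y 0 (inK _ yr) K0) _.
    rewrite ler_wpM2l// ge0_ler_powR ?nnegrE ?l2norm_ge0 ?(ltW r0)//.
      exact: ltW (lt_trans beta0 beta_gamma).
    exact: ltW yr.
  have := taylor2 u2r Hr xr; rewrite add0r => H.
  have -> : quad (u 0) (grad u 0) A0 x = u 0 + \sum_i x 0 i * partial i u 0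
      + 2^-1 * qform (hessian u 0) x.
    rewrite /quad qform_sympart; congr (_ + _ + _).
    by apply: eq_bigr => i _; rewrite mxE mulrC.
  rewrite !opprD !addrA; apply: le_trans H _; apply: le_trans rhoP.
  have -> : rho `^ (2 + gamma) = rho `^ gamma * rho ^+ 2.
    rewrite powRD; last by apply/implyP => _; rewrite gt_eqF.
    by rewrite powR_mulrn ?(ltW r0)// mulrC.
  rewrite mulrA; apply: ler_wpM2l; first by rewrite mulr_ge0// powR_ge0.
  by rewrite ler_pXn2r ?nnegrE ?l2norm_ge0 ?(ltW r0)// ltW.
have ln0 : 0 < lam * n%:R by rewrite mulr_gt0// ltr0n.
pose e1 := lam * n%:R * (rho `^ th / 2).
have e10 : 0 < e1 by rewrite mulr_gt0// divr_gt0.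
have e20 : 0 < rho `^ th / 4 by rewrite divr_gt0.
have /(@cvgrPdist_lt _ _ _ U _)/(_ _ e10) N1 := GkG A0.
have N2 := unif _ e20.
have N3 : U [set k | k.+2%:R^-1 <= rho].
  apply: ooU; near=> k; apply: ltW; rewrite -[ltRHS]invrK ltf_pV2 ?posrE ?invr_gt0//.
  have : k%:R > rho^-1 by near: k; exact: nbhs_infty_gtr.
  by move=> H; apply: (lt_trans H); rewrite ltr_nat.
have N12 : U ([set k | `|G A0 - Gk k A0| < e1] `&` [set k | k.+2%:R^-1 <= rho]).
  exact: filterI.
have [k [[n1 n3] n2]] := @filter_ex2 _ U _ _ _ N12 N2.
have [_ kbad] := GuP k.
have [s sP Gs] := elliptic_correction lam0 A0 n0 (F_unif_elliptic (FGk k)).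
apply: (kbad rho); first by rewrite r2 andbT.
exists (u 0), (grad u 0), (A0 + s *: idS R n); split=> // x xr.
have s1 : `|s| <= rho `^ th / 2.
  apply: le_trans sP _; rewrite ler_pdivrMr// mulrC; apply: ltW.
  by move: n1; rewrite /= GA0 sub0r normrN.
have -> : quad (u 0) (grad u 0) (A0 + s *: idS R n) x
    = quad (u 0) (grad u 0) A0 x + 2^-1 * (s * l2norm x ^+ 2).
  by rewrite /quad symMD bformDM idSZE qform_scalar; ring.
have x1 : l2norm x <= 1.
  by move: xr; rewrite /eball/= subr0 => /ltW xr; apply: le_trans xr _; lra.
have s2 : `|2^-1 * (s * l2norm x ^+ 2)| <= rho `^ th / 4.
  have sq : 0 <= l2norm x ^+ 2 by rewrite exprn_ge0// l2norm_ge0.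
  rewrite normrM [`|s * _|]normrM (ger0_norm sq) (ger0_norm (ltW half0)).
  have : `|s| * l2norm x ^+ 2 <= `|s|.
    by rewrite ler_piMr// exprn_ile1// l2norm_ge0.
  by move=> *; lra.
have := n2 x; rewrite /eball/= subr0.
have := xr; rewrite /eball/= subr0 => xr' /(_ (lt_le_trans xr' r2)).
move: (T x xr) s2; rewrite -/th -/(w k) !ler_norml.
by move=> /andP[? ?] /andP[? ?] /andP[? ?]; apply/andP; split; lra.
Unshelve. all: by end_near.
Qed.

End compactness.

(** * Iteration over scales *)

Lemma powR_div (R : realType) (a b th : R) : 0 <= a -> 0 < b ->
  b `^ th * (a / b) `^ th = a `^ th.
Proof.
move=> a0 b0; rewrite -powRM ?divr_ge0 ?(ltW b0)//.
by rewrite mulrCA divff ?gt_eqF// mulr1.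
Qed.

Lemma visc_sol_sub (R : realType) n (G : symM R n -> R) (U V : set 'rV[R]_n) u :
  V `<=` U -> visc_sol G U u -> visc_sol G V u.
Proof.
move=> VU [cu su Su]; split=> [x /VU|x W phi /VU|x W phi /VU]; first exact: cu.
  exact: su.
exact: Su.
Qed.

Section iteration.
Context (R : realType) (n : nat) (F : set (symM R n -> R)) (beta : R).
Context (delta : R).
Hypothesis Fshift : forall G A (t : R), F G -> G A = 0 -> 0 < t ->
  F (shift_scale A t G).
Hypothesis delta0 : 0 < delta.
Hypothesis delta2 : delta <= 2^-1.
Hypothesis beta0 : 0 < beta.
Hypothesis scaleP : forall G u, normalized_solution F G u ->
  exists2 rho, delta <= rho <= 2^-1 & approximable beta G u rho.

Let th := 2 + beta.
Let C := (delta `^ th)^-1.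

Let th0 : 0 < th. Proof. by rewrite addr_gt0. Qed.

(** One step: subtracting the good polynomial at scale [rho] and zooming in
    yields another normalized solution, for another operator of the family. *)
Lemma zoom G u rho a b (A : symM R n) : 0 < rho <= 1 ->
  normalized_solution F G u -> G A = 0 ->
  (forall x, eball 0 rho x -> `|u x - quad a b A x| <= rho `^ th) ->
  normalized_solution F (shift_scale A ((rho `^ th)^-1 * rho ^+ 2) G)
    (rescale (rho `^ th)^-1 rho 0 a b A u).
Proof.
move=> /andP[r0 r1] [FG uG u1] GA uP.
have p0 : 0 < rho `^ th by rewrite powR_gt0.
have ip0 : 0 < (rho `^ th)^-1 by rewrite invr_gt0.
split.
- by apply: Fshift => //; rewrite mulr_gt0// exprn_gt0.
- apply: (visc_sol_rescale ip0 r0) => //; rewrite mulr1.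
  by apply: visc_sol_sub uG => z; rewrite /eball/= => /lt_le_trans; apply.
- move=> y yB; rewrite /rescale normrM gtr0_norm// mulrC ler_pdivrMr// mul1r.
  rewrite add0r; apply: uP; move: yB; rewrite /eball/= !subr0 l2normZ gtr0_norm//.
  by move=> yB; rewrite gtr_pMr.
Qed.

Lemma approximation_large_scale G u r : normalized_solution F G u ->
  delta <= r <= 1 ->
  exists a b (A : symM R n), forall x, eball 0 r x ->
    `|u x - quad a b A x| <= C * r `^ th.
Proof.
move=> [_ _ u1] /andP[dr r1]; exists 0, 0, 0 => x xr.
rewrite (_ : symM_val 0 = 0)// quad0 subr0.
apply: (@le_trans _ _ 1); first by apply: u1; exact: lt_le_trans xr r1.
rewrite mulrC ler_pdivlMr ?powR_gt0// mul1r.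
have r0 : 0 <= r by rewrite (le_trans (ltW delta0)).
by rewrite ge0_ler_powR ?nnegrE// ltW.
Qed.

(** Below the scale [delta], zooming in by [rho <= 1/2] at least doubles the
    radius; adding the rescaled polynomials back preserves the constant [C]
    because the error was normalized by [rho ^ th]. *)
Lemma approximation_dyadic k G u r : normalized_solution F G u ->
  2^-1 ^+ k <= r <= 1 ->
  exists a b (A : symM R n), forall x, eball 0 r x ->
    `|u x - quad a b A x| <= C * r `^ th.
Proof.
elim: k => [|k IH] in G u r *; move=> uN /andP[kr r1].
  apply: approximation_large_scale uN _; rewrite r1 andbT.
  by move: kr; rewrite expr0; apply: le_trans; have := delta2; lra.
have [dr|rd] := leP delta r.
  by apply: approximation_large_scale uN _; rewrite dr.
have [rho /andP[drho rho2] [a [b [A [GA uP]]]]] := scaleP uN.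
have rho0 : 0 < rho by exact: lt_le_trans drho.
have rho01 : 0 < rho <= 1 by rewrite rho0/= (le_trans rho2)//; lra.
have r0 : 0 < r by apply: lt_le_trans kr; rewrite exprn_gt0// invr_gt0.
have rr : 2^-1 ^+ k <= r / rho <= 1.
  rewrite ler_pdivlMr// ler_pdivrMr// mul1r (le_trans (ltW rd) drho) andbT.
  by apply: le_trans kr; rewrite exprSr; apply: ler_wpM2l.
have [a' [b' [A' vP]]] := IH _ _ _ (zoom rho01 uN GA uP) rr.
have p0 : 0 < rho `^ th by rewrite powR_gt0.
exists (a + rho `^ th * a'), (b + rho `^ th *: (rho^-1 *: b')),
  (A + rho `^ th *: (rho^-1 ^+ 2 *: A')) => x xr.
have := vP (rho^-1 *: x); rewrite /rescale add0r scalerA divff ?gt_eqF// scale1r.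
rewrite quad_scale.
have -> : symM_val (A + rho `^ th *: (rho^-1 ^+ 2 *: A'))
    = symM_val A + rho `^ th *: (rho^-1 ^+ 2 *: symM_val A') by [].
rewrite -quad_lin; set q := quad a' _ _ _ => H.
have -> : u x - (quad a b A x + rho `^ th * q)
    = rho `^ th * ((rho `^ th)^-1 * (u x - quad a b A x) - q).
  by rewrite mulrBr mulrA divff ?gt_eqF// mul1r opprD addrA.
rewrite normrM gtr0_norm//.
rewrite -(powR_div th (ltW r0) rho0) mulrCA ler_pM2l//; apply: H.
move: xr; rewrite /eball/= !subr0 l2normZ gtr0_norm ?invr_gt0// mulrC => xr.
by rewrite ltr_pM2r// invr_gt0.
Qed.

Lemma approximation_at_center G u r : normalized_solution F G u -> 0 < r <= 1 ->
  exists a b (A : symM R n), forall x, eball 0 r x ->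
    `|u x - quad a b A x| <= C * r `^ th.
Proof.
move=> uN /andP[r0 r1].
have [k kr] : exists k, 2^-1 ^+ k <= r.
  have h : `|2^-1 : R| < 1 by rewrite ger0_norm ?invr_ge0// invf_lt1// ltr1n.
  have /cvgrPdist_lt/(_ _ r0) := @cvg_expr R _ h.
  move=> /filter_ex[k]; rewrite sub0r normrN ger0_norm ?exprn_ge0 ?invr_ge0//.
  by move=> /ltW; exists k.
by apply: (@approximation_dyadic k _ _ _ uN); rewrite kr.
Qed.

(** Recentring: half-size balls around points of the half ball stay inside. *)
Lemma approximation_at_point G u x0 r : (forall G, F G -> G 0 = 0) ->
  normalized_solution F G u -> eball 0 2^-1 x0 -> 0 < r <= 2^-1 ->
  exists a b (A : symM R n), forall x, eball x0 r x ->
    `|u x - quad a b A x| <= C * 2 `^ th * r `^ th.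
Proof.
move=> F0 [FG uG u1] x0B /andP[r0 r2].
have h0 : (0 : R) < 2^-1 by rewrite invr_gt0.
have sub : eball x0 (2^-1 * 1) `<=` eball 0 1.
  move=> z; move: x0B; rewrite /eball/= => x0B zx0.
  apply: (le_lt_trans (l2normB_triangle x0 _ _)); lra.
have vN : normalized_solution F (shift_scale (0 : symM R n) (1 * 2^-1 ^+ 2) G)
    (rescale 1 2^-1 x0 0 0 (0 : symM R n) u).
  split.
  - apply: Fshift; [exact: FG | exact: F0 | by rewrite mul1r exprn_gt0].
  - apply: visc_sol_rescale => //; first exact: F0.
    exact: visc_sol_sub uG.
  - move=> y yB; rewrite /rescale (_ : symM_val 0 = 0)// quad0 subr0 mul1r.
    apply: u1; apply: sub; move: yB; rewrite /eball/= subr0 => yB.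
    by rewrite addrAC subrr add0r l2normZ gtr0_norm// ltr_pM2l.
have rr : 0 < 2 * r <= 1 by apply/andP; split; lra.
have [a [b [A vP]]] := approximation_at_center vN rr.
have A4T : (2 ^+ 2 *: symM_val A)^T = 2 ^+ 2 *: symM_val A.
  by rewrite linearZ/= symM_tr.
have [a' [b' E]] := quad_translate a (2 *: b) (- x0) A4T.
exists a', b', (2 ^+ 2 *: A) => x xr.
have := vP (2 *: (x - x0)); rewrite quad_scale -/(symM_val _) E.
rewrite /rescale scalerA mulVf// scale1r (_ : symM_val 0 = 0)// quad0 subr0.
rewrite mul1r powRM ?(ltW r0)// mulrA (_ : x0 + (x - x0) = x); last first.
  by rewrite addrC subrK.
apply; move: xr; rewrite /eball/= subr0 l2normZ gtr0_norm// => xr.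
by rewrite ltr_pM2l.
Qed.

End iteration.

(** * From polynomial approximation to Hessian estimates *)

Lemma powR_one (R : realType) (r : R) : 1 `^ r = 1.
Proof. by rewrite powR1. Qed.

Section hessian_estimate.
Context (R : realType) (n : nat) (beta C : R) (u : 'rV[R]_n -> R).
Context (H : 'rV[R]_n -> 'M[R]_n).
Hypothesis beta0 : 0 < beta.
Hypothesis C0 : 0 <= C.
Hypothesis u1 : forall x, eball 0 1 x -> `|u x| <= 1.
Hypothesis uH : forall i j x s, eball 0 2^-1 x -> 0 <= s -> s <= 8^-1 ->
  exists2 z, l2norm (z - x) <= s *+ 2 & mixed_diff u i j s x = s ^+ 2 * H z i j.
Hypothesis cH : forall i j x, eball 0 2^-1 x ->
  {for x, continuous (fun y => H y i j)}.
Hypothesis approx : forall x0 r, eball 0 2^-1 x0 -> 0 < r <= 2^-1 ->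
  exists a b (A : symM R n), forall x, eball x0 r x ->
    `|u x - quad a b A x| <= C * r `^ (2 + beta).

(* Four points and r = 4 * s give the error 4 * C * (4 * s) `^ (2 + beta), hence
   the quotients at scales s and s / 2 differ by (1 + 4) * 64 * C * 4 `^ beta
   times s `^ beta; summing over dyadic scales is a geometric series of ratio q. *)
Let K1 := 80 * C * 4 `^ beta * 4.
Let q := (2^-1 : R) `^ beta.
Let K2 := K1 / (1 - q).

Let q_lt1 : q < 1.
Proof.
rewrite /q -[ltRHS](powR_one beta) gt0_ltr_powR// ?nnegrE ?invr_ge0//.
by rewrite invf_lt1// ltr1n.
Qed.

Let q_ge0 : 0 <= q. Proof. exact: powR_ge0. Qed.

Let K1_ge0 : 0 <= K1.
Proof. by rewrite !mulr_ge0// powR_ge0. Qed.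

Let K2_ge0 : 0 <= K2.
Proof. by rewrite divr_ge0// subr_ge0 ltW. Qed.

Let e (i : 'I_n) : 'rV[R]_n := delta_mx 0 i.

Lemma mixed_diff_points x i j s : 0 <= s ->
  [/\ l2norm (x + s *: e i + s *: e j - x) <= s *+ 2,
      l2norm (x + s *: e j - x) <= s *+ 2,
      l2norm (x + s *: e i - x) <= s *+ 2 & l2norm (x - x) <= s *+ 2].
Proof.
move=> s0; have ne k : l2norm (s *: e k) = s.
  by rewrite l2normZ l2norm_delta mulr1 ger0_norm.
have E (w : 'rV[R]_n) : x + w - x = w by rewrite addrAC subrr add0r.
split.
- by rewrite -(addrA x) E (le_trans (l2normD _ _))// !ne mulr2n.
- by rewrite E ne mulr2n lerDl.
- by rewrite E ne mulr2n lerDl.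
- by rewrite subrr l2norm0 mulrn_wge0.
Qed.

(** At scales below [r] the mixed difference quotients only see the quadratic
    polynomial that approximates [u] on the ball of radius [r]. *)
Lemma mixed_diff_approx x0 r y i j s a b (A : symM R n) : 0 <= s ->
  l2norm (y - x0) + s *+ 2 < r ->
  (forall x, eball x0 r x -> `|u x - quad a b A x| <= C * r `^ (2 + beta)) ->
  `|mixed_diff u i j s y - s ^+ 2 * (A : 'M[R]_n) i j|
    <= 4 * (C * r `^ (2 + beta)).
Proof.
move=> s0 yr uA; rewrite -(mixed_diff_quad a b y i j s (symM_tr A)).
have inB z : l2norm (z - y) <= s *+ 2 -> eball x0 r z.
  move=> zy; rewrite /eball/=; apply: le_lt_trans (l2normB_triangle y _ _) _.
  by apply: le_lt_trans yr; rewrite addrC lerD2l.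
have [/inB/uA p1 /inB/uA p2 /inB/uA p3 /inB/uA p4] := mixed_diff_points y i j s0.
move: p1 p2 p3 p4; rewrite /mixed_diff -/(e i) -/(e j) !ler_norml.
move=> /andP[? ?] /andP[? ?] /andP[? ?] /andP[? ?].
by apply/andP; split; lra.
Qed.

Let f i j x s := mixed_diff u i j s x / s ^+ 2.

Let pow4 : (4 : R) `^ (2 + beta) = 16 * 4 `^ beta.
Proof.
rewrite powRD; last by apply/implyP => _; rewrite gt_eqF.
by rewrite powR_mulrn//; congr (_ * _); ring.
Qed.

Lemma quotient_halving i j x s : eball 0 2^-1 x -> 0 < s -> s <= 8^-1 ->
  `|f i j x s - f i j x (s / 2)| <= K1 * s `^ beta.
Proof.
move=> xB s0 s8.
have r0 : 0 < 4 * s <= 2^-1 by apply/andP; split; lra.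
have [a [b [A uA]]] := approx xB r0.
have P1 : l2norm (x - x) + s *+ 2 < 4 * s by rewrite subrr l2norm0 mulr2n; lra.
have P2 : l2norm (x - x) + (s / 2) *+ 2 < 4 * s.
  by rewrite subrr l2norm0 mulr2n; lra.
have sh0 : 0 <= s / 2 by rewrite divr_ge0// ltW.
have := mixed_diff_approx i j (ltW s0) P1 uA.
have := mixed_diff_approx i j sh0 P2 uA.
rewrite -(powR_div (2 + beta) (a := 4 * s) (b := s)) ?mulr_ge0 ?(ltW s0)//.
rewrite mulfK ?gt_eqF// pow4 powRD; last first.
  by apply/implyP => _; rewrite gt_eqF.
rewrite powR_mulrn ?(ltW s0)//.
set B := 4 * _; set a1 := (A : 'M[R]_n) i j => T2 T1.
have s2 : 0 < s ^+ 2 by rewrite exprn_gt0.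
have EB : B = s ^+ 2 * (16 * C * 4 `^ beta * 4 * s `^ beta).
  by rewrite /B; ring.
have F1 : `|f i j x s - a1| <= 16 * C * 4 `^ beta * 4 * s `^ beta.
  have -> : f i j x s - a1 = (s ^+ 2)^-1 * (mixed_diff u i j s x - s ^+ 2 * a1).
    by rewrite /f; field; rewrite gt_eqF.
  by rewrite normrM gtr0_norm ?invr_gt0// ler_pdivrMl// -EB.
have F2 : `|f i j x (s / 2) - a1| <= 4 * (16 * C * 4 `^ beta * 4 * s `^ beta).
  have -> : f i j x (s / 2) - a1
      = (s ^+ 2)^-1 * (4 * (mixed_diff u i j (s / 2) x - (s / 2) ^+ 2 * a1)).
    by rewrite /f; field; rewrite gt_eqF.
  rewrite normrM gtr0_norm ?invr_gt0// ler_pdivrMl// mulrCA -EB.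
  by rewrite normrM gtr0_norm// ler_pM2l.
have -> : f i j x s - f i j x (s / 2) = (f i j x s - a1) - (f i j x (s / 2) - a1).
  by ring.
apply: le_trans (ler_normB _ _) _; apply: le_trans (lerD F1 F2) _.
by rewrite /K1 le_eqVlt; apply/orP; left; apply/eqP; ring.
Qed.

Lemma quotient_dyadic m i j x s : eball 0 2^-1 x -> 0 < s -> s <= 8^-1 ->
  `|f i j x s - f i j x (s * 2^-1 ^+ m)| <= K2 * s `^ beta.
Proof.
elim: m s => [|m IH] s xB s0 s8.
  by rewrite expr0 mulr1 subrr normr0 mulr_ge0// powR_ge0.
have sh0 : 0 < s / 2 by rewrite divr_gt0.
have sh8 : s / 2 <= 8^-1 by lra.
have := IH (s / 2) xB sh0 sh8; have := quotient_halving i j xB s0 s8.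
rewrite powRM ?(ltW s0) ?invr_ge0// -/q -mulrA -exprS => T1 T2.
have -> : f i j x s - f i j x (s * 2^-1 ^+ m.+1)
    = (f i j x s - f i j x (s / 2))
      + (f i j x (s / 2) - f i j x (s * 2^-1 ^+ m.+1)) by ring.
apply: le_trans (ler_normD _ _) _; apply: le_trans (lerD T1 T2) _.
have -> : K2 * s `^ beta = K1 * s `^ beta + K2 * (s `^ beta * q).
  by rewrite /K2; field; rewrite gt_eqF// subr_gt0.
by [].
Qed.

(** The quotients converge to the Hessian entry as [s] tends to [0]; the
    telescoping sum of their dyadic increments turns this into a rate. *)
Lemma quotient_hessian i j x s : eball 0 2^-1 x -> 0 < s -> s <= 8^-1 ->
  `|f i j x s - H x i j| <= K2 * s `^ beta.
Proof.
move=> xB s0 s8; apply/ler_addgt0Pr => eps eps0.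
have /continuous_eballP/(_ _ eps0)[t t0 tP] := @cH i j x xB.
have [m mt] : exists m, 2^-1 ^+ m < t / (s *+ 2).
  have h : `|2^-1 : R| < 1 by rewrite ger0_norm ?invr_ge0// invf_lt1// ltr1n.
  have d0 : 0 < t / (s *+ 2) by rewrite divr_gt0// mulrn_wgt0.
  have /cvgrPdist_lt/(_ _ d0) := @cvg_expr R _ h.
  move=> /filter_ex[k]; rewrite sub0r normrN ger0_norm ?exprn_ge0 ?invr_ge0//.
  by exists k.
pose s' := s * 2^-1 ^+ m.
have s'0 : 0 < s' by rewrite mulr_gt0// exprn_gt0 ?invr_gt0.
have s'8 : s' <= 8^-1.
  apply: le_trans s8; rewrite /s' ger_pMr// exprn_ile1 ?invr_ge0//.
  by rewrite invf_le1// ler1n.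
have [z zx E] := @uH i j x s' xB (ltW s'0) s'8.
have zt : eball x t z.
  apply: le_lt_trans zx _; move: mt; rewrite ltr_pdivlMr ?mulrn_wgt0//.
  by rewrite /s' -mulrnAl mulrC.
have Ef : f i j x s' = H z i j.
  by rewrite /f E mulrC mulrA mulVf ?mul1r// expf_neq0// gt_eqF.
have -> : f i j x s - H x i j = (f i j x s - f i j x s') + (H z i j - H x i j).
  by rewrite Ef; ring.
apply: le_trans (ler_normD _ _) _; apply: lerD; first exact: quotient_dyadic.
by rewrite distrC ltW// tP.
Qed.

(** [256] bounds the quotient at scale [1/8]: four values of size [1], divided
    by [1/64]. *)
Definition hessian_bound : R := K2 + 256.

Let hessian_bound_ge0 : 0 <= hessian_bound.
Proof. by apply: addr_ge0; [exact: K2_ge0 | exact: ler0n]. Qed.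

Lemma hessian_entry_bound i j x : eball 0 2^-1 x -> `|H x i j| <= hessian_bound.
Proof.
move=> xB; have s0 : (0 : R) < 8^-1 by rewrite invr_gt0.
have := quotient_hessian i j xB s0 (lexx _).
have p1 : (8^-1 : R) `^ beta <= 1.
  rewrite -[leRHS](powR_one beta) ge0_ler_powR ?nnegrE ?(ltW beta0)// ?(ltW s0)//.
  by rewrite invf_le1// ler1n.
have inB z : l2norm (z - x) <= 8^-1 *+ 2 -> `|u z| <= 1.
  move=> zx; apply: u1; rewrite /eball/= subr0.
  have := l2normD (z - x) x; rewrite subrK.
  by move: xB zx; rewrite /eball/= subr0 (mulr2n 8^-1) => *; lra.
have [/inB b1 /inB b2 /inB b3 /inB b4] := mixed_diff_points x i j (ltW s0).
have fb : `|f i j x 8^-1| <= 256.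
  rewrite /f normrM [`|(_ ^+ 2)^-1|]gtr0_norm ?invr_gt0 ?exprn_gt0//.
  rewrite ler_pdivrMr ?exprn_gt0//.
  have -> : 256 * 8^-1 ^+ 2 = 4 :> R by field.
  move: b1 b2 b3 b4; rewrite /mixed_diff -/(e i) -/(e j) !ler_norml.
  move=> /andP[? ?] /andP[? ?] /andP[? ?] /andP[? ?].
  by apply/andP; split; lra.
move=> T.
have -> : H x i j = f i j x 8^-1 - (f i j x 8^-1 - H x i j) by ring.
apply: le_trans (ler_normB _ _) _; rewrite /hessian_bound addrC.
apply: lerD => //; apply: le_trans T _; by rewrite ler_piMr.
Qed.

Definition hessian_hoelder_bound : R :=
  2 * K2 + 128 * C * 4 `^ beta + 2 * hessian_bound * 8 `^ beta.

Let P0 : 0 <= 2 * hessian_bound * 8 `^ beta.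
Proof. by apply: mulr_ge0; [exact: mulr_ge0 | exact: powR_ge0]. Qed.

Let Q0 : 0 <= 2 * K2 + 128 * C * 4 `^ beta.
Proof.
apply: addr_ge0; first by exact: mulr_ge0.
by apply: mulr_ge0; [apply: mulr_ge0 => //; exact: ler0n | exact: powR_ge0].
Qed.

Lemma hessian_hoelder_bound_ge0 : 0 <= hessian_hoelder_bound.
Proof. exact: addr_ge0 Q0 P0. Qed.

(** Both quotients at the scale [d], the distance of the two points, are close
    to the same entry of the polynomial that approximates [u] at scale [4 * d]. *)
Lemma hessian_entry_hoelder i j x y : eball 0 2^-1 x -> eball 0 2^-1 y ->
  `|H x i j - H y i j| <= hessian_hoelder_bound * l2norm (x - y) `^ beta.
Proof.
move=> xB yB; have [<-|/eqP xy] := eqVneq x y.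
  rewrite subrr normr0; apply: mulr_ge0; last exact: powR_ge0.
  exact: hessian_hoelder_bound_ge0.
set d := l2norm (x - y).
have d0 : 0 < d by rewrite l2norm_gt0// => /subr0_eq.
have db0 : 0 <= d `^ beta by exact: powR_ge0.
have [d8|d8] := leP d 8^-1; last first.
  apply: le_trans (ler_normB _ _) _.
  apply: le_trans (lerD (hessian_entry_bound _ _ xB) (hessian_entry_bound _ _ yB)) _.
  rewrite /hessian_hoelder_bound mulrDl ler_wpDl// ?mulr_ge0//.
  rewrite -[_ * _ * d `^ beta]mulrA -powRM// ?(ltW d0)//.
  have -> : hessian_bound + hessian_bound = 2 * hessian_bound * 1 by ring.
  apply: ler_wpM2l; first by rewrite mulr_ge0.
  rewrite -[leLHS](powR_one beta) ge0_ler_powR ?nnegrE ?(ltW beta0)// ?mulr_ge0 ?(ltW d0)//.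
  by lra.
have r0 : 0 < 4 * d <= 2^-1 by apply/andP; split; lra.
have [a [b [A uA]]] := approx xB r0.
have P1 : l2norm (x - x) + d *+ 2 < 4 * d by rewrite subrr l2norm0 mulr2n; lra.
have P2 : l2norm (y - x) + d *+ 2 < 4 * d by rewrite l2normBC -/d mulr2n; lra.
have := mixed_diff_approx i j (ltW d0) P1 uA.
have := mixed_diff_approx i j (ltW d0) P2 uA.
rewrite -(powR_div (2 + beta) (a := 4 * d) (b := d)) ?mulr_ge0 ?(ltW d0)//.
rewrite mulfK ?gt_eqF// pow4 powRD; last first.
  by apply/implyP => _; rewrite gt_eqF.
rewrite powR_mulrn ?(ltW d0)//.
set B := 4 * _; set a1 := (A : 'M[R]_n) i j => T2 T1.
have s2 : 0 < d ^+ 2 by rewrite exprn_gt0.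
have EB : B = d ^+ 2 * (64 * C * 4 `^ beta * d `^ beta) by rewrite /B; ring.
have F z : `|mixed_diff u i j d z - d ^+ 2 * a1| <= B ->
    `|f i j z d - a1| <= 64 * C * 4 `^ beta * d `^ beta.
  have -> : f i j z d - a1 = (d ^+ 2)^-1 * (mixed_diff u i j d z - d ^+ 2 * a1).
    by rewrite /f; field; rewrite gt_eqF.
  by rewrite normrM gtr0_norm ?invr_gt0// ler_pdivrMl// -EB.
have Hx := quotient_hessian i j xB d0 d8; have Hy := quotient_hessian i j yB d0 d8.
have -> : H x i j - H y i j = - (f i j x d - H x i j) + (f i j x d - a1)
    - (f i j y d - a1) + (f i j y d - H y i j) by ring.
have := F _ T1; have := F _ T2 => T3 T4.
rewrite /hessian_hoelder_bound mulrDl ler_wpDr ?mulr_ge0//.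
have -> : (2 * K2 + 128 * C * 4 `^ beta) * d `^ beta
    = K2 * d `^ beta + 64 * C * 4 `^ beta * d `^ beta
      + 64 * C * 4 `^ beta * d `^ beta + K2 * d `^ beta by ring.
apply: le_trans (ler_normD _ _) _; apply: lerD => //.
apply: le_trans (ler_normB _ _) _; apply: lerD => //.
by apply: le_trans (ler_normD _ _) _; apply: lerD => //; rewrite normrN.
Qed.

End hessian_estimate.

(** * The uniform estimate *)

Lemma lipschitz_partial (R : realType) n (u : 'rV[R]_n -> R) x r L i :
  0 < r -> derivable u x (delta_mx 0 i) ->
  (forall y, eball x r y -> `|u y - u x| <= L * l2norm (y - x)) ->
  `|partial i u x| <= L.
Proof.
move=> r0 du uL; apply/ler_addgt0Pr => e e0.
have C : h^-1 *: ((u \o shift x) (h *: delta_mx 0 i) - u x) @[h --> (0:R)^']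
    --> partial i u x by exact: du.
have /(@cvgrPdist_lt _ _ _ ((0:R)^') _)/(_ _ e0) N1 :=
  C.
have N2 : \forall h \near (0:R)^', `|h| < r by exact: dnbhs0_lt.
have N3 : \forall h \near (0:R)^', h != 0 by exact: nbhs_dnbhs_neq.
have N23 : (0:R)^' ([set h | `|h| < r] `&` [set h | h != 0]) by exact: filterI.
have [h [h1 [hr h0]]] := @filter_ex2 _ ((0:R)^') _ _ _ N1 N23.
have nh : 0 < `|h| by rewrite normr_gt0.
have q : `|h^-1 *: ((u \o shift x) (h *: delta_mx 0 i) - u x)| <= L.
  rewrite normrM normfV ler_pdivrMl//=.
  have E : h *: delta_mx 0 i + x - x = h *: delta_mx 0 i :> 'rV[R]_n by rewrite addrK.
  have := uL (h *: delta_mx 0 i + x).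
  by rewrite /eball/= E l2normZ l2norm_delta mulr1 mulrC => /(_ hr).
have D (a b : R) : `|a - b| < e -> `|b| <= L -> `|a| <= L + e.
  move=> ab bL; rewrite -(subrK b a) addrC; apply: le_trans (ler_normD _ _) _.
  by rewrite lerD// ltW.
exact: D h1 q.
Qed.

Lemma sup_norm_le (R : realType) m n p (g : 'rV[R]_n -> 'M[R]_(m, p)) E (k c d : R) :
  0 <= k -> (forall x, E x -> l2norm (g x) <= c) -> k * c <= d ->
  (k%:E * sup_norm g E <= d%:E)%E.
Proof.
move=> k0 gc kcd; apply: (@le_trans _ _ (k%:E * c%:E)%E); last by rewrite lee_fin.
rewrite lee_wpmul2l ?lee_fin//; apply: ge_ereal_sup => _ [x Ex <-].
by rewrite lee_fin; exact: gc.
Qed.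

Lemma hoelder_seminorm_le (R : realType) m n p beta (g : 'rV[R]_n -> 'M[R]_(m, p))
    E (k c d : R) : 0 <= k ->
  (forall x y, E x -> E y -> l2norm (g x - g y) <= c * l2norm (x - y) `^ beta) ->
  k * c <= d -> (k%:E * hoelder_seminorm beta g E <= d%:E)%E.
Proof.
move=> k0 gc kcd; apply: (@le_trans _ _ (k%:E * c%:E)%E); last by rewrite lee_fin.
rewrite lee_wpmul2l ?lee_fin//; apply: ge_ereal_sup => _ [x [y [Ex Ey xy ->]]].
rewrite lee_fin ler_pdivrMr; first exact: gc.
by rewrite powR_gt0// l2norm_gt0// => /subr0_eq.
Qed.

Lemma osc_finite (R : realType) n (E : set 'rV[R]_n) (u : 'rV[R]_n -> R) x0 :
  E x0 -> osc E u = +oo%E \/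
  exists m o : R, [/\ osc E u = o%:E, 0 <= o & forall x, E x -> `|u x - m| <= o].
Proof.
move=> Ex0; rewrite /osc.
have sup_ub x : E x -> ((u x)%:E <= ereal_sup [set (u x)%:E | x in E])%E.
  by move=> Ex; apply: ereal_sup_ubound; exists x.
have inf_lb x : E x -> (ereal_inf [set (u x)%:E | x in E] <= (u x)%:E)%E.
  by move=> Ex; apply: ereal_inf_lbound; exists x.
move: sup_ub inf_lb; case: (ereal_sup _) => [S||] supP; last 2 first.
- case: (ereal_inf _) => [I||] infP; [by left| |by left].
  by have := infP _ Ex0.
- by have := supP _ Ex0.
case: (ereal_inf _) => [I||] infP; [|by have := infP _ Ex0|by left].
right; exists I, (S - I); split.
- by rewrite EFinB.
- have := supP _ Ex0; have := infP _ Ex0; rewrite !lee_fin subr_ge0.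
  exact: le_trans.
- move=> x Ex; have := supP _ Ex; have := infP _ Ex; rewrite !lee_fin => a b.
  by rewrite ger0_norm ?subr_ge0// lerD2r.
Qed.

Section uniform_estimate.
Context (R : realType) (n : nat) (F : set (symM R n -> R)) (beta L HB HH : R).
Hypothesis F0 : forall G, F G -> G 0 = 0.
Hypothesis Fshift : forall G A (t : R), F G -> G A = 0 -> 0 < t ->
  F (shift_scale A t G).
Hypothesis F2 : forall G v, normalized_solution F G v -> C2 (eball 0 1) v.
Hypothesis gradF : forall G v x i, normalized_solution F G v ->
  eball 0 2^-1 x -> `|partial i v x| <= L.
Hypothesis hessF : forall G v x i j, normalized_solution F G v ->
  eball 0 2^-1 x -> `|hessian v x i j| <= HB.
Hypothesis hoelderF : forall G v x y i j, normalized_solution F G v ->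
  eball 0 2^-1 x -> eball 0 2^-1 y ->
  `|hessian v x i j - hessian v y i j| <= HH * l2norm (x - y) `^ beta.

(** The derivatives of [u] are those of the normalized solution [v], because
    [u] is in turn a pullback of [v] by an affine map. *)
Lemma estimate_by_bound G x0 r u m w : F G -> 0 < r -> 0 < w ->
  visc_sol G (eball x0 r) u -> (forall x, eball x0 r x -> `|u x - m| <= w) ->
  (r%:E * sup_norm (grad u) (eball x0 (r / 2))
    + (r ^+ 2)%:E * sup_norm (hessian u) (eball x0 (r / 2))
    + (r `^ (2 + beta))%:E * hoelder_seminorm beta (hessian u) (eball x0 (r / 2))
  <= ((n%:R * L + (n * n)%:R * HB + (n * n)%:R * HH) * w)%:E)%E.
Proof.
move=> FG r0 w0 uG um.
have iw0 : 0 < w^-1 by rewrite invr_gt0.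
have ir0 : 0 < r^-1 by rewrite invr_gt0.
pose v := rescale w^-1 r x0 m 0 (0 : symM R n) u.
have vE y : v y = w^-1 * (u (x0 + r *: y) - m) by rewrite /v /rescale quad0.
have vN : normalized_solution F (shift_scale (0 : symM R n) (w^-1 * r ^+ 2) G) v.
  split.
  - apply: Fshift; [exact: FG|exact: F0|].
    by rewrite mulr_gt0// exprn_gt0.
  - by apply: visc_sol_rescale => //; [exact: F0|rewrite mulr1].
  - move=> y yB; rewrite vE normrM gtr0_norm// ler_pdivrMl// mulr1; apply: um.
    move: yB; rewrite /eball/= subr0 => yB.
    by rewrite addrAC subrr add0r l2normZ gtr0_norm// gtr_pMr.
have v2 := F2 vN.
have uE : u = pullback w r^-1 x0 v m 0 0.
  apply/funext => z; rewrite /pullback quad0 vE scalerA divff ?gt_eqF//.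
  rewrite scale1r (_ : x0 + (z - x0) = z); last by rewrite addrC subrK.
  by rewrite mulrA divff ?gt_eqF// mul1r subrK.
pose T z := r^-1 *: (z - x0).
have TB z : eball x0 (r / 2) z -> eball 0 2^-1 (T z).
  rewrite /eball/= subr0 l2normZ gtr0_norm// => zr.
  by rewrite ltr_pdivrMl.
have TB1 z : eball x0 (r / 2) z -> eball 0 1 (T z).
  by move=> /TB; rewrite /eball/= => H; lra.
have hessE z : eball x0 (r / 2) z ->
    hessian u z = (w * r^-1 ^+ 2) *: hessian v (T z).
  move=> /TB1 zB; rewrite [in LHS]uE.
  rewrite (hessian_pullback w m 0 (trmx0 _ _ _) (@open_eball R n 0 1) v2 zB).
  by rewrite addr0.
have gradE z i : eball x0 (r / 2) z ->
    partial i u z = (w * r^-1) * partial i v (T z).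
  move=> /TB1 zB; rewrite [in LHS]uE.
  rewrite (partial_pullback w m 0 (trmx0 _ _ _) v2 i zB).
  by rewrite /pullback row0 quad0 mxE addr0.
have wr0 : 0 <= w * r^-1 by rewrite mulr_ge0// ltW.
have wr20 : 0 <= w * r^-1 ^+ 2 by rewrite mulr_ge0 ?exprn_ge0// ltW.
have -> : (n%:R * L + (n * n)%:R * HB + (n * n)%:R * HH) * w
    = n%:R * L * w + (n * n)%:R * HB * w + (n * n)%:R * HH * w by ring.
rewrite !EFinD; apply: leeD; [apply: leeD|].
- apply: (@sup_norm_le _ _ _ _ _ _ _ (n%:R * (w * r^-1 * L))); first exact: ltW.
    move=> x xB; apply: le_trans (@l2norm_le_entries _ _ _ _ (w * r^-1 * L) _) _.
      move=> i0 j; rewrite mxE gradE// normrM ger0_norm//.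
      apply: ler_wpM2l => //; exact: gradF vN (TB _ xB).
    by rewrite mul1n.
  by rewrite le_eqVlt; apply/orP; left; apply/eqP; field; rewrite gt_eqF.
- apply: (@sup_norm_le _ _ _ _ _ _ _ ((n * n)%:R * (w * r^-1 ^+ 2 * HB))).
  + by rewrite exprn_ge0// ltW.
  + move=> x xB; apply: l2norm_le_entries => i j.
    rewrite hessE// [X in `|X|]mxE normrM ger0_norm//.
    apply: ler_wpM2l => //; exact: hessF vN (TB _ xB).
  + by rewrite le_eqVlt; apply/orP; left; apply/eqP; field; rewrite gt_eqF.
- apply: (@hoelder_seminorm_le _ _ _ _ _ _ _ _
    ((n * n)%:R * (w * r^-1 ^+ 2 * (HH * r^-1 `^ beta)))).
  + exact: powR_ge0.
  + move=> x y xB yB; apply: le_trans (@l2norm_le_entries _ _ _ _ (w * r^-1 ^+ 2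
      * (HH * r^-1 `^ beta) * l2norm (x - y) `^ beta) _) _; last by rewrite !mulrA.
    move=> i j.
    rewrite !hessE// -scalerBr [X in `|X|]mxE mxBE normrM ger0_norm//.
    have := hoelderF i j vN (TB _ xB) (TB _ yB).
    have -> : l2norm (T x - T y) = r^-1 * l2norm (x - y).
      by rewrite /T -scalerBr opprB addrA subrK l2normZ gtr0_norm.
    rewrite powRM ?l2norm_ge0 ?(ltW ir0)// mulrA => H.
    by rewrite -(mulrA (w * _)); apply: ler_wpM2l.
  + have E : r `^ beta * r^-1 `^ beta = 1.
      by rewrite -powRM ?(ltW r0) ?(ltW ir0)// divff ?gt_eqF// powR_one.
    rewrite powRD; last by apply/implyP => _; rewrite gt_eqF.
    rewrite powR_mulrn ?(ltW r0)//.
    have -> : r ^+ 2 * r `^ beta *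
        ((n * n)%:R * (w * r^-1 ^+ 2 * (HH * r^-1 `^ beta)))
      = (n * n)%:R * HH * w * (r `^ beta * r^-1 `^ beta).
      by field; rewrite gt_eqF.
    by rewrite E mulr1.
Qed.

(** Letting the bound decrease to the oscillation also covers constant
    functions; an infinite oscillation makes the estimate trivial. *)
Lemma estimate_by_osc G x0 r u C : 0 < C ->
  n%:R * L + (n * n)%:R * HB + (n * n)%:R * HH <= C ->
  F G -> 0 < r -> visc_sol G (eball x0 r) u ->
  (r%:E * sup_norm (grad u) (eball x0 (r / 2))
    + (r ^+ 2)%:E * sup_norm (hessian u) (eball x0 (r / 2))
    + (r `^ (2 + beta))%:E * hoelder_seminorm beta (hessian u) (eball x0 (r / 2))
  <= C%:E * osc (eball x0 r) u)%E.
Proof.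
move=> C0 KC FG r0 uG.
have [->|[m [d [-> d_ge0 ud]]]] := osc_finite u (eball_center x0 r0).
  by rewrite mulry gtr0_sg// mul1e leey.
apply/lee_addgt0Pr => e e0; rewrite -EFinM -EFinD.
have w0 : 0 < d + e / C by rewrite ltr_wpDl// divr_gt0.
have uw x : eball x0 r x -> `|u x - m| <= d + e / C.
  by move=> /ud H; apply: le_trans H _; rewrite lerDl ltW// divr_gt0.
apply: le_trans (estimate_by_bound FG r0 w0 uG uw) _.
rewrite lee_fin; apply: le_trans (ler_wpM2r (ltW w0) KC) _.
by rewrite mulrDr mulrCA divff ?gt_eqF// mulr1.
Qed.

End uniform_estimate.

Theorem theorem5p8 (R : realType) (n : nat) (lam Lam gamma : R)
    (F : set (symM R n -> R)) :
  (2 <= n)%N -> 0 < lam -> lam <= Lam -> 0 < gamma -> gamma <= 1 ->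
  F !=set0 ->
  F `<=` elliptic lam Lam ->
  compact (F : set {family compact, symM R n -> R}) ->
  (forall G A (t : R), F G -> G A = 0 -> 0 < t -> F (shift_scale A t G)) ->
  (forall G x0 (r : R) u, F G -> 0 < r -> visc_sol G (eball x0 r) u ->
     C2hoelder_loc gamma (eball x0 r) u) ->
  forall beta : R, 0 < beta -> beta < gamma ->
  exists2 C : R, 0 < C &
    forall G x0 (r : R) u, F G -> 0 < r -> visc_sol G (eball x0 r) u ->
      (r%:E * sup_norm (grad u) (eball x0 (r / 2))
       + (r ^+ 2)%:E * sup_norm (hessian u) (eball x0 (r / 2))
       + (r `^ (2 + beta))%:E
         * hoelder_seminorm beta (hessian u) (eball x0 (r / 2))
       <= C%:E * osc (eball x0 r) u)%E.

Proof.
move=> n2 lam0 lamLam gamma0 gamma1 [G0 FG0] FE Fc Fshift Freg beta beta0 bg.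
have n0 : (0 < n)%N by exact: ltnW.
have F0 G : F G -> G 0 = 0 by move=> /FE[].
have [delta /andP[d0 d2] scale] :=
  exists_scale n0 lam0 lamLam FE Fc Freg beta0 bg.
have C2F G v : normalized_solution F G v -> C2 (eball 0 1) v.
  exact: normalized_C2 Freg _ _.
pose K := (delta `^ (2 + beta))^-1 * 2 `^ (2 + beta).
have K0 : 0 <= K by rewrite mulr_ge0 ?invr_ge0 ?powR_ge0.
have approx G v : normalized_solution F G v ->
    forall x0 r, eball 0 2^-1 x0 -> 0 < r <= 2^-1 ->
    exists a b (A : symM R n), forall x, eball x0 r x ->
      `|v x - quad a b A x| <= K * r `^ (2 + beta).
  move=> vN x0 r x0B rr.
  exact: (approximation_at_point Fshift d0 d2 beta0 scale F0 vN x0B rr).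
have mixed G v : normalized_solution F G v ->
    forall i j x s, eball 0 2^-1 x -> 0 <= s -> s <= 8^-1 ->
    exists2 z, l2norm (z - x) <= s *+ 2
      & mixed_diff v i j s x = s ^+ 2 * hessian v z i j.
  move=> vN i j x s xB s0 s8.
  apply: (@mixed_diff_hessian _ _ _ _ 2^-1) => //.
    apply: C2_sub (C2F _ _ vN); apply: eball_sub.
    by move: xB; rewrite /eball/= => ?; lra.
  by rewrite mulr2n; lra.
have half : eball (0 : 'rV[R]_n) 2^-1 `<=` eball 0 1.
  by move=> z; rewrite /eball/= => zB; lra.
have cH G v : normalized_solution F G v ->
    forall i j x, eball 0 2^-1 x -> {for x, continuous (fun y => hessian v y i j)}.
  move=> vN i j x /half xB; have [_ _ H] := C2F _ _ vN _ xB.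
  rewrite (_ : (fun y => _) = partial i (partial j v)); first by case: (H i j).
  by apply/funext => y; rewrite hessianE.
have v1 G v : normalized_solution F G v ->
    forall x, eball 0 1 x -> `|v x| <= 1 by case.
have gradF G v x i : normalized_solution F G v -> eball 0 2^-1 x ->
    `|partial i v x| <= lipschitz_const n lam Lam.
  move=> vN xB; have [_ H _] := C2F _ _ vN _ (half _ xB).
  have /nbhs_eball /nbhs_eballP[r r0 rP] := xB.
  apply: (lipschitz_partial r0 (H i).1) => y /rP yB.
  exact: (normalized_lipschitz lam0 lamLam FE Freg vN yB xB).
have hessF G v x i j : normalized_solution F G v -> eball 0 2^-1 x ->
    `|hessian v x i j| <= hessian_bound beta K.
  move=> vN; exact: (hessian_entry_bound beta0 K0 (v1 _ _ vN) (mixed _ _ vN)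
    (cH _ _ vN) (approx _ _ vN)).
have hoelderF G v x y i j : normalized_solution F G v ->
    eball 0 2^-1 x -> eball 0 2^-1 y ->
    `|hessian v x i j - hessian v y i j|
      <= hessian_hoelder_bound beta K * l2norm (x - y) `^ beta.
  move=> vN; exact: (hessian_entry_hoelder beta0 K0 (v1 _ _ vN) (mixed _ _ vN)
    (cH _ _ vN) (approx _ _ vN)).
pose C := n%:R * lipschitz_const n lam Lam
  + (n * n)%:R * hessian_bound beta K + (n * n)%:R * hessian_hoelder_bound beta K.
exists (`|C| + 1); first by rewrite ltr_wpDl.
move=> G x0 r u FG r0 uG.
have C0 : 0 < `|C| + 1 by rewrite ltr_wpDl.
have CC : C <= `|C| + 1 by rewrite (le_trans (ler_norm _))// lerDl.
exact: (estimate_by_osc F0 Fshift C2F gradF hessF hoelderF C0 CC FG r0 uG).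
Qed.
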